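(* Let $G=\langle e_1,e_2\rangle$ be the free abelian group of rank $2$ with free generators $e_1,e_2$, let $\mathbb{K}$ be an infinite field, and let $J\subseteq\mathcal{L}(X^G)$ be a $T_G$-ideal such that $\mathrm{Id}_G(\mathrm{UT}_3^{(-)}(\mathbb{K}),\Gamma(e_1,e_2))\subseteq J$. Then there exists a finite subset $S\subseteq\mathcal{L}(X^G)$ such that $$J=\langle S\rangle^{T_G}+\mathrm{Id}_G(\mathrm{UT}_3^{(-)},\Gamma(e_1,e_2)).$$
   Context: $\mathrm{UT}_3^{(-)}=\mathrm{UT}_3(\mathbb{K})^{(-)}$ is the Lie algebra of upper triangular $3\times3$ matrices over $\mathbb{K}$ with bracket $[a,b]=ab-ba$; $e_{ij}$ are matrix units. For an abelian group $G$ (multiplicative, neutral element $1$) and $g,h\in G$, $\Gamma(g,h)$ is the $G$-grading on $\mathrm{UT}_3^{(-)}$ with $\deg e_{ii}=1$, $\deg e_{12}=g$, $\deg e_{23}=h$, $\deg e_{13}=gh$. $\mathcal{L}(X^G)$ is the free $G$-graded Lie algebra over $\mathbb{K}$ freely generated by $X^G=\{x_{i,g}\mid i\in\mathbb{N},g\in G\}$ with $\deg x_{i,g}=g$. $\mathrm{Id}_G(\mathrm{UT}_3^{(-)},\Gamma)$ is the set of $f\in\mathcal{L}(X^G)$ that vanish under every graded homomorphism $\mathcal{L}(X^G)\to(\mathrm{UT}_3^{(-)},\Gamma)$. A $T_G$-ideal is an ideal of $\mathcal{L}(X^G)$ invariant under all graded endomorphisms, and $\langle S\rangle^{T_G}$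 is the $T_G$-ideal generated by $S$. *)

(* Defs.v *)
From HB Require Import structures.
From mathcomp Require Import all_boot all_order all_algebra.
From mathcomp Require Import boolp classical_sets cardinality.

Set Implicit Arguments.
Unset Strict Implicit.
Unset Printing Implicit Defensive.

Import GRing.Theory.
Local Open Scope classical_set_scope.
Local Open Scope ring_scope.

(* The bracket is alternating, not merely antisymmetric, since fields of       *)
(* characteristic 2 are allowed.                                               *)
HB.mixin Record Lmodule_isLie (K : fieldType) L of GRing.Lmodule K L := {
  lie : L -> L -> L;
  lie_linearl : forall z : L, linear (lie^~ z);
  lie_linearr : forall x : L, linear (lie x);
  liexx : forall x : L, lie x x = 0;
  lie_jacobi : forall x y z : L,
    lie x (lie y z) + lie y (lie z x) + lie z (lie x y) = 0
}.

#[short(type="lieAlgType")]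
HB.structure Definition LieAlgebra (K : fieldType) :=
  {L of GRing.Lmodule K L & Lmodule_isLie K L}.

(* The free Lie algebra on X: formal expressions in the operations of a Lie    *)
(* K-algebra, modulo the congruence generated by the axioms of Lie algebras.   *)
Inductive lie_term (K X : Type) : Type :=
| LVar of X
| LZero
| LOpp of lie_term K X
| LAdd of lie_term K X & lie_term K X
| LScale of K & lie_term K X
| LBr of lie_term K X & lie_term K X.

Arguments LVar {K X}.
Arguments LZero {K X}.

Inductive lie_cong (K : fieldType) (X : Type) :
    lie_term K X -> lie_term K X -> Prop :=
| lc_refl s : lie_cong s s
| lc_sym s t : lie_cong s t -> lie_cong t s
| lc_trans s t u : lie_cong s t -> lie_cong t u -> lie_cong s u
| lc_opp s s' : lie_cong s s' -> lie_cong (LOpp s) (LOpp s')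
| lc_add s s' t t' : lie_cong s s' -> lie_cong t t' ->
    lie_cong (LAdd s t) (LAdd s' t')
| lc_scale a s s' : lie_cong s s' -> lie_cong (LScale a s) (LScale a s')
| lc_br s s' t t' : lie_cong s s' -> lie_cong t t' ->
    lie_cong (LBr s t) (LBr s' t')
| lc_addA s t u : lie_cong (LAdd s (LAdd t u)) (LAdd (LAdd s t) u)
| lc_addC s t : lie_cong (LAdd s t) (LAdd t s)
| lc_add0 s : lie_cong (LAdd LZero s) s
| lc_addN s : lie_cong (LAdd (LOpp s) s) LZero
| lc_scaleA a b s : lie_cong (LScale a (LScale b s)) (LScale (a * b) s)
| lc_scale1 s : lie_cong (LScale 1 s) s
| lc_scaleDr a s t :
    lie_cong (LScale a (LAdd s t)) (LAdd (LScale a s) (LScale a t))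
| lc_scaleDl a b s :
    lie_cong (LScale (a + b) s) (LAdd (LScale a s) (LScale b s))
| lc_brl a s t u :
    lie_cong (LBr (LAdd (LScale a s) t) u) (LAdd (LScale a (LBr s u)) (LBr t u))
| lc_brr a s t u :
    lie_cong (LBr u (LAdd (LScale a s) t)) (LAdd (LScale a (LBr u s)) (LBr u t))
| lc_brxx s : lie_cong (LBr s s) LZero
| lc_jacobi s t u :
    lie_cong (LAdd (LAdd (LBr s (LBr t u)) (LBr t (LBr u s))) (LBr u (LBr s t)))
             LZero.

HB.instance Definition _ (K X : Type) := gen_eqMixin (lie_term K X).
HB.instance Definition _ (K X : Type) := gen_choiceMixin (lie_term K X).

Section FreeLie.
Context (K : fieldType) (X : Type).

Definition lie_congb (s t : lie_term K X) : bool := `[< lie_cong s t >].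

Lemma lie_congb_refl : reflexive lie_congb.
Proof. by move=> s; apply/asboolP; exact: lc_refl. Qed.

Lemma lie_congb_sym : symmetric lie_congb.
Proof. by move=> s t; apply/asboolP/asboolP; exact: lc_sym. Qed.

Lemma lie_congb_trans : transitive lie_congb.
Proof.
by move=> t s u /asboolP st /asboolP tu; apply/asboolP; exact: lc_trans st tu.
Qed.

Canonical lie_congb_equiv :=
  EquivRel lie_congb lie_congb_refl lie_congb_sym lie_congb_trans.

Definition free_lie : Type := {eq_quot lie_congb}%qT.

HB.instance Definition _ := Choice.on free_lie.

Definition fl_class (t : lie_term K X) : free_lie := \pi_{eq_quot lie_congb}%qT t.
Definition fl_repr (x : free_lie) : lie_term K X :=
  repr (x : {eq_quot lie_congb}%qT).

Lemma fl_reprK x : fl_class (fl_repr x) = x.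
Proof. exact: reprK. Qed.

Lemma fl_classP s t : (fl_class s = fl_class t) <-> lie_cong s t.
Proof.
split=> [/eqP|st]; first by rewrite /fl_class piE => /asboolP.
by apply/eqP; rewrite /fl_class piE; apply/asboolP.
Qed.

Lemma fl_repr_class t : lie_cong (fl_repr (fl_class t)) t.
Proof. by apply/fl_classP; rewrite fl_reprK. Qed.

Lemma fl_ind (P : free_lie -> Prop) :
  (forall t, P (fl_class t)) -> forall x, P x.
Proof. by move=> Pt x; rewrite -(fl_reprK x). Qed.

Definition fl_opp (x : free_lie) := fl_class (LOpp (fl_repr x)).
Definition fl_add (x y : free_lie) := fl_class (LAdd (fl_repr x) (fl_repr y)).
Definition fl_scale (a : K) (x : free_lie) := fl_class (LScale a (fl_repr x)).
Definition fl_br (x y : free_lie) := fl_class (LBr (fl_repr x) (fl_repr y)).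

Lemma fl_oppE s : fl_opp (fl_class s) = fl_class (LOpp s).
Proof. by apply/fl_classP/lc_opp/fl_repr_class. Qed.

Lemma fl_addE s t : fl_add (fl_class s) (fl_class t) = fl_class (LAdd s t).
Proof. by apply/fl_classP/lc_add; exact: fl_repr_class. Qed.

Lemma fl_scaleE a s : fl_scale a (fl_class s) = fl_class (LScale a s).
Proof. by apply/fl_classP/lc_scale/fl_repr_class. Qed.

Lemma fl_brE s t : fl_br (fl_class s) (fl_class t) = fl_class (LBr s t).
Proof. by apply/fl_classP/lc_br; exact: fl_repr_class. Qed.

Definition fl_opsE := (fl_oppE, fl_addE, fl_scaleE, fl_brE).

Lemma fl_addA : associative fl_add.
Proof.
elim/fl_ind=> s; elim/fl_ind=> t; elim/fl_ind=> u.
by rewrite !fl_opsE; apply/fl_classP; constructor.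
Qed.

Lemma fl_addC : commutative fl_add.
Proof.
elim/fl_ind=> s; elim/fl_ind=> t.
by rewrite !fl_opsE; apply/fl_classP; apply: lc_addC.
Qed.

Lemma fl_add0 : left_id (fl_class LZero) fl_add.
Proof. by elim/fl_ind=> s; rewrite !fl_opsE; apply/fl_classP; apply: lc_add0. Qed.

Lemma fl_addN : left_inverse (fl_class LZero) fl_opp fl_add.
Proof. by elim/fl_ind=> s; rewrite !fl_opsE; apply/fl_classP; apply: lc_addN. Qed.

HB.instance Definition _ :=
  GRing.isZmodule.Build free_lie fl_addA fl_addC fl_add0 fl_addN.

Lemma fl_scaleA a b x : fl_scale a (fl_scale b x) = fl_scale (a * b) x.
Proof.
by elim/fl_ind: x => s; rewrite !fl_opsE; apply/fl_classP; apply: lc_scaleA.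
Qed.

Lemma fl_scale1 : left_id 1 fl_scale.
Proof. by elim/fl_ind=> s; rewrite !fl_opsE; apply/fl_classP; apply: lc_scale1. Qed.

Lemma fl_scaleDr : right_distributive fl_scale +%R.
Proof.
move=> a; elim/fl_ind=> s; elim/fl_ind=> t; rewrite /GRing.add /= !fl_opsE.
by apply/fl_classP; apply: lc_scaleDr.
Qed.

Lemma fl_scaleDl x : {morph fl_scale^~ x : a b / a + b}.
Proof.
elim/fl_ind: x => s a b; rewrite [in RHS]/GRing.add /= !fl_opsE.
by apply/fl_classP; apply: lc_scaleDl.
Qed.

HB.instance Definition _ := GRing.Zmodule_isLmodule.Build K free_lie
  fl_scaleA fl_scale1 fl_scaleDr fl_scaleDl.

Lemma fl_br_linearl z : linear (fl_br^~ z).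
Proof.
elim/fl_ind: z => u a; elim/fl_ind=> s; elim/fl_ind=> t.
rewrite /GRing.add /GRing.scale /= !fl_opsE.
by apply/fl_classP; apply: lc_brl.
Qed.

Lemma fl_br_linearr x : linear (fl_br x).
Proof.
elim/fl_ind: x => u a; elim/fl_ind=> s; elim/fl_ind=> t.
rewrite /GRing.add /GRing.scale /= !fl_opsE.
by apply/fl_classP; apply: lc_brr.
Qed.

Lemma fl_brxx x : fl_br x x = 0.
Proof.
by elim/fl_ind: x => s; rewrite !fl_opsE; apply/fl_classP; apply: lc_brxx.
Qed.

Lemma fl_jacobi x y z :
  fl_br x (fl_br y z) + fl_br y (fl_br z x) + fl_br z (fl_br x y) = 0.
Proof.
elim/fl_ind: x => s; elim/fl_ind: y => t; elim/fl_ind: z => u.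
rewrite /GRing.add /= !fl_opsE.
by apply/fl_classP; apply: lc_jacobi.
Qed.

HB.instance Definition _ := Lmodule_isLie.Build K free_lie
  fl_br_linearl fl_br_linearr fl_brxx fl_jacobi.

Definition fl_var (i : X) : free_lie := fl_class (LVar i).

End FreeLie.

Arguments fl_var K {X}.

Section UniversalProperty.
Context (K : fieldType) (X : Type) (M : lieAlgType K) (v : X -> M).

Fixpoint lie_eval (t : lie_term K X) : M :=
  match t with
  | LVar i => v i
  | LZero => 0
  | LOpp s => - lie_eval s
  | LAdd s t => lie_eval s + lie_eval t
  | LScale a s => a *: lie_eval s
  | LBr s t => lie (lie_eval s) (lie_eval t)
  end.

Lemma lie_eval_cong s t : lie_cong s t -> lie_eval s = lie_eval t.
Proof.
elim=> //= {s t}.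
- by move=> s t u _ -> _ ->.
- by move=> s s' _ ->.
- by move=> s s' t t' _ -> _ ->.
- by move=> a s s' _ ->.
- by move=> s s' t t' _ -> _ ->.
- by move=> s t u; rewrite addrA.
- by move=> s t; rewrite addrC.
- by move=> s; rewrite add0r.
- by move=> s; rewrite addNr.
- by move=> a b s; rewrite scalerA.
- by move=> s; rewrite scale1r.
- by move=> a s t; rewrite scalerDr.
- by move=> a b s; rewrite scalerDl.
- by move=> a s t u; rewrite lie_linearl.
- by move=> a s t u; rewrite lie_linearr.
- by move=> s; rewrite liexx.
- by move=> s t u; rewrite lie_jacobi.
Qed.

Definition fl_lift (x : free_lie K X) : M := lie_eval (fl_repr x).

Lemma fl_liftE t : fl_lift (fl_class t) = lie_eval t.
Proof. by apply/lie_eval_cong/fl_repr_class. Qed.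

Lemma fl_lift_linear : linear fl_lift.
Proof.
move=> a; elim/fl_ind=> s; elim/fl_ind=> t.
rewrite [in LHS]/GRing.add [in LHS]/GRing.scale /= !fl_opsE.
by rewrite !fl_liftE.
Qed.

HB.instance Definition _ :=
  GRing.isLinear.Build K (free_lie K X) M *:%R fl_lift fl_lift_linear.

Lemma fl_lift_lie x y : fl_lift (lie x y) = lie (fl_lift x) (fl_lift y).
Proof.
elim/fl_ind: x => s; elim/fl_ind: y => t.
by rewrite [in LHS]/lie /= !fl_opsE !fl_liftE.
Qed.

Lemma fl_lift_var i : fl_lift (fl_var K i) = v i.
Proof. exact: fl_liftE. Qed.

Lemma fl_lift_unique (f : {linear free_lie K X -> M}) :
    (forall x y, f (lie x y) = lie (f x) (f y)) ->
    (forall i, f (fl_var K i) = v i) ->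
  forall x, f x = fl_lift x.
Proof.
move=> f_lie f_var; elim/fl_ind; elim=> [i||s IHs|s IHs t IHt|a s IHs|s IHs t IHt].
- by rewrite fl_lift_var -f_var.
- by rewrite !(linear0 f, linear0 fl_lift).
- by rewrite -fl_oppE (linearN f) (linearN fl_lift) IHs.
- by rewrite -fl_addE (linearD f) (linearD fl_lift) IHs IHt.
- by rewrite -fl_scaleE (linearZZ f) (linearZZ fl_lift) IHs.
- by rewrite -fl_brE f_lie fl_lift_lie IHs IHt.
Qed.

End UniversalProperty.

(* Abelian groups are written additively.  A G-grading on L is given by the    *)
(* family G -> set L of its homogeneous components.                            *)

Record graded_hom (K : fieldType) (G : zmodType) (L M : lieAlgType K)
    (cL : G -> set L) (cM : G -> set M) (f : {linear L -> M}) : Prop := {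
  graded_hom_lie : forall x y, f (lie x y) = lie (f x) (f y);
  graded_hom_deg : forall g x, cL g x -> cM g (f x)
}.

Section FreeGraded.
Context (K : fieldType) (G : zmodType).

(* The generator x_{i,g} is fl_var K (i, g).                                   *)
Definition free_graded_lie : Type := free_lie K (nat * G).

HB.instance Definition _ := LieAlgebra.on free_graded_lie.

(* The component of degree g is the span of the iterated brackets of           *)
(* generators whose degrees add up to g.                                       *)
Inductive free_comp : G -> set free_graded_lie :=
| free_comp_var i g : free_comp g (fl_var K (i, g))
| free_comp_0 g : free_comp g 0
| free_comp_lin g a x y :
    free_comp g x -> free_comp g y -> free_comp g (a *: x + y)
| free_comp_lie g h x y :
    free_comp g x -> free_comp h y -> free_comp (g + h) (lie x y).

Record is_TG_ideal (J : set free_graded_lie) : Prop := {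
  TG_ideal0 : J 0;
  TG_ideal_lin : forall a x y, J x -> J y -> J (a *: x + y);
  TG_ideal_lie : forall x y, J y -> J (lie x y);
  TG_ideal_endo : forall f : {linear free_graded_lie -> free_graded_lie},
    graded_hom free_comp free_comp f -> forall x, J x -> J (f x)
}.

Definition TG_ideal_gen (S : set free_graded_lie) : set free_graded_lie :=
  smallest is_TG_ideal S.

Definition graded_identities (M : lieAlgType K) (cM : G -> set M) :
    set free_graded_lie :=
  [set f | forall phi : {linear free_graded_lie -> M},
             graded_hom free_comp cM phi -> phi f = 0].

End FreeGraded.

Section UT3.
Context (K : fieldType).

(* is_trig_mx means lower triangular, whence the transpose.                    *)
Definition upper3_pred : {pred 'M[K]_3} := fun A => is_trig_mx A^T.
Definition upper3 := [qualify a A | upper3_pred A].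

Lemma upper3P (A : 'M[K]_3) :
  reflect (forall i j : 'I_3, (j < i)%N -> A i j = 0) (A \is a upper3).
Proof.
by apply: (iffP is_trig_mxP) => A0 i j ij; have:= A0 _ _ ij; rewrite mxE.
Qed.

Fact upper3_submod_closed : submod_closed upper3.
Proof.
split=> [|a A B /upper3P A0 /upper3P B0]; apply/upper3P => i j ij.
  by rewrite mxE.
by rewrite !mxE A0 // B0 // mulr0 addr0.
Qed.

HB.instance Definition _ := GRing.isSubmodClosed.Build K 'M[K]_3 upper3_pred
  upper3_submod_closed.

Lemma upper3_mulmx A B :
  A \is a upper3 -> B \is a upper3 -> A *m B \is a upper3.
Proof.
move=> /upper3P A0 /upper3P B0; apply/upper3P => i j ij; rewrite mxE big1 // => k _.
have [ki|ik] := ltnP k i; first by rewrite A0 // mul0r.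
by rewrite B0 ?mulr0 //; exact: leq_trans ij ik.
Qed.

Record UT3 : Type := MkUT3 { ut3_mx :> 'M[K]_3; _ : ut3_mx \is a upper3 }.

HB.instance Definition _ := [isSub for ut3_mx].
HB.instance Definition _ := [Choice of UT3 by <:].
HB.instance Definition _ := [SubChoice_isSubLmodule of UT3 by <:].

Fact ut3_br_subproof (A B : UT3) : A *m B - B *m A \is a upper3.
Proof. by apply: rpredB; apply: upper3_mulmx; apply: valP. Qed.

Definition ut3_br (A B : UT3) : UT3 := MkUT3 (ut3_br_subproof A B).

Lemma ut3_br_linearl C : linear (ut3_br^~ C).
Proof.
move=> a A B; apply: val_inj => /=.
rewrite mulmxDl mulmxDr -scalemxAl -scalemxAr scalerBr opprD !addrA.
by congr (_ - _); rewrite addrAC.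
Qed.

Lemma ut3_br_linearr C : linear (ut3_br C).
Proof.
move=> a A B; apply: val_inj => /=.
rewrite mulmxDl mulmxDr -scalemxAl -scalemxAr scalerBr opprD !addrA.
by congr (_ - _); rewrite addrAC.
Qed.

Lemma ut3_brxx A : ut3_br A A = 0.
Proof. by apply: val_inj => /=; rewrite subrr. Qed.

Lemma ut3_jacobi A B C :
  ut3_br A (ut3_br B C) + ut3_br B (ut3_br C A) + ut3_br C (ut3_br A B) = 0.
Proof.
apply: val_inj => /=; rewrite !mulmxBl !mulmxBr !mulmxA !opprB !addrA.
rewrite !subrK (ACl (1*8*(2*5)*(3*6)*(4*7)))%AC /=.
by rewrite !subrr !addNr !addr0.
Qed.

HB.instance Definition _ := Lmodule_isLie.Build K UT3
  ut3_br_linearl ut3_br_linearr ut3_brxx ut3_jacobi.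

Section Grading.
Context (G : zmodType) (g h : G).

(* The degree of the matrix unit e_{ij}; indices start at 0, and the value is  *)
(* irrelevant for j < i.                                                       *)
Definition ut3_deg (i j : 'I_3) : G :=
  match val i, val j with
  | 0%N, 1%N => g
  | 1%N, 2%N => h
  | 0%N, 2%N => g + h
  | _, _ => 0
  end.

(* The component of degree d of Gamma(g, h): the span of the matrix units of   *)
(* degree d.                                                                   *)
Definition ut3_comp (d : G) : set UT3 :=
  [set A | forall i j, A i j != 0 -> ut3_deg i j = d].

End Grading.
End UT3.

Definition free_abelian_basis2 (G : zmodType) (e1 e2 : G) : Prop :=
  bijective (fun p : int * int => e1 *~ p.1 + e2 *~ p.2).

(* Main.v *)
(* Modulo the identities of UT3 the free graded Lie algebra is spanned by the  *)
(* degree 0 variables y_i and by z_i, w_i, u_i, [z_i, w_j] (of degrees e1, e2, *)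
(* e1 + e2, e1 + e2) acted upon by the y's.  If y_k is the diagonal matrix     *)
(* (a_k, b_k, c_k), then ad y_k multiplies e12, e23, e13 by p_k = a_k - b_k,   *)
(* q_k = b_k - c_k and p_k + q_k, so each family is a polynomial module in the *)
(* p_k, q_k; a T_G-ideal meets it in a submodule stable under multiplication   *)
(* and under increasing changes of the indices of the y's.  Such submodules    *)
(* are finitely generated up to these operations (Cohen): by Higman's lemma    *)
(* finitely many leading monomials suffice, and one reduces modulo them.       *)

From HB Require Import structures.
Require Import Defs.
From mathcomp Require Import all_boot all_order all_algebra.
From mathcomp Require Import boolp classical_sets cardinality.
From mathcomp Require Import ring.

Set Implicit Arguments.
Unset Strict Implicit.
Unset Printing Implicit Defensive.

Import GRing.Theory.
Local Open Scope classical_set_scope.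
Local Open Scope ring_scope.

(** It suffices to find a finite subset S of J such that every T_G-ideal containing S and the
    identities contains J ([stable_finitely_generated]); this is applied to the sum of the T_G-ideal
    generated by S and the ideal of identities.

    Since e1 and e2 are independent, the graded homomorphisms to UT3 are parametrised by scalars, so
    congruence modulo the identities is equality of explicit matrices ([identityP]). The span of the
    monomials [mon c w] is closed under brackets with generators, hence is everything modulo the
    identities ([spanned_all]). Substituting 0 for variables isolates the part of an element in each
    class c ([proj_mon_sum]), and these parts stay in J.

    Within one of the five kinds of classes, if a word u embeds letterwise into v, a graded
    endomorphism carries the monomial of u to that of v and words below u to words below v
    ([mon_shift]). Dickson's lemma for letters and Higman's lemma for words exclude infinite bad
    sequences for this embedding ([word_good]). So finitely many leading words suffice for J, and
    reduction to smaller words terminates ([stable_finite_basis]). *)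

(** * Well-quasi-orders and Higman's lemma *)

Inductive emb (A : Type) (r : A -> A -> Prop) : seq A -> seq A -> Prop :=
| emb_nil v : emb r [::] v
| emb_skip y u v : emb r u v -> emb r u (y :: v)
| emb_cons x y u v : r x y -> emb r u v -> emb r (x :: u) (y :: v).

(** Well-quasi-order in its Ramsey form: all pairs of the subsequence are related, so that products
    are handled by extracting twice. *)
Definition perfect (A : Type) (r : A -> A -> Prop) : Prop :=
  forall a : nat -> A, exists h : nat -> nat,
    {homo h : i j / (i < j)%N} /\ forall i j, (i < j)%N -> r (a (h i)) (a (h j)).

Definition bad (A : Type) (r : A -> A -> Prop) (g : nat -> A) : Prop :=
  forall i j, (i < j)%N -> ~ r (g i) (g j).

Lemma perfect_leq : perfect (fun m n : nat => (m <= n)%N).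
Proof.
move=> a.
(* A minimum of [a] over the indices from n on; jumping from one such minimum to the next gives a
   nondecreasing subsequence. *)
have argmin n : exists m, (n <= m)%N /\ forall k, (n <= k)%N -> (a m <= a k)%N.
  pose P v := `[< exists2 m, (n <= m)%N & a m = v >].
  have exP : exists v, P v by exists (a n); apply/asboolP; exists n.
  case: (ex_minnP exP) => v /asboolP[m nm <-] vmin.
  by exists m; split=> // k nk; apply: vmin; apply/asboolP; exists k.
have [f fP] := choice argmin.
pose h := fix h n := if n is n'.+1 then f (h n').+1 else f 0%N.
have hS n : (h n < h n.+1)%N by case: (fP (h n).+1).
have hh : {homo h : i j / (i < j)%N} by apply: homo_ltn => //; exact: ltn_trans.
exists h; split=> // -[|i] j ij /=; first by case: (fP 0%N) => _; apply.
by case: (fP (h i).+1) => _; apply; apply: hh; exact: ltnW.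
Qed.

Lemma perfect_pair (A B : Type) (r : A -> A -> Prop) (s : B -> B -> Prop) :
  perfect r -> perfect s ->
  perfect (fun x y : A * B => r x.1 y.1 /\ s x.2 y.2).
Proof.
move=> rP sP a; have [h [hh hr]] := rP (fst \o a).
have [k [kk ks]] := sP (snd \o a \o h); exists (h \o k); split=> [i j ij|i j ij].
  by apply/hh/kk.
by split; [apply/hr/kk | apply: ks].
Qed.

Section Higman.
Context (A : Type) (r : A -> A -> Prop).
Local Notation badseq := (bad (emb r)).

Let agree n (g g' : nat -> seq A) := forall k, (k < n)%N -> g' k = g k.

Lemma minimal_bad_step n g : badseq g -> exists g', [/\ badseq g', agree n g g'
  & forall g'', badseq g'' -> agree n g g'' -> (size (g' n) <= size (g'' n))%N].
Proof.
move=> gbad.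
pose P v := `[< exists g', [/\ badseq g', agree n g g' & size (g' n) = v] >].
have exP : exists v, P v by exists (size (g n)); apply/asboolP; exists g; split.
case: (ex_minnP exP) => v /asboolP[g' [g'bad gg' <-]] vmin.
exists g'; split=> // g'' ? ?; apply: vmin; apply/asboolP; by exists g''.
Qed.

Lemma minimal_bad g0 : badseq g0 -> exists m, badseq m /\
  forall n g, badseq g -> agree n m g -> (size (m n) <= size (g n))%N.
Proof.
move=> g0bad.
have step (x : nat * (nat -> seq A)) : exists g', badseq x.2 ->
    [/\ badseq g', agree x.1 x.2 g' & forall g'', badseq g'' ->
        agree x.1 x.2 g'' -> (size (g' x.1) <= size (g'' x.1))%N].
  have [xbad|nbad] := pselect (badseq x.2); last by exists x.2.
  by have [g' g'P] := minimal_bad_step x.1 xbad; exists g'.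
have [f fP] := choice step.
pose s := fix s n := if n is n'.+1 then f (n', s n') else g0.
have sbad n : badseq (s n) by elim: n => //= n /(fP (n, s n))[].
have sS n : agree n (s n) (s n.+1) by case: (fP (n, s n) (sbad n)).
have smin n g : badseq g -> agree n (s n) g -> (size (s n.+1 n) <= size (g n))%N.
  by case: (fP (n, s n) (sbad n)) => _ _; apply.
have sE n k : (k < n)%N -> s n k = s k.+1 k.
  elim: n => // n IH; rewrite ltnS leq_eqVlt => /predU1P[->//|kn].
  by rewrite sS // IH.
(* The diagonal: stage n.+1 fixes the term n for good, so every initial part of the diagonal lies in
   a bad sequence. *)
exists (fun n => s n.+1 n); split=> [i j ij|n g gbad gm].
  rewrite -(sE j.+1 i) ?(leq_trans ij) //; exact: sbad.
by apply: smin => // k kn; rewrite gm // sE.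
Qed.

(* Nash-Williams: in a minimal bad sequence, cut the heads off along a         *)
(* subsequence whose heads increase; the result is a smaller bad sequence.     *)
Lemma higman : perfect r -> forall g, ~ badseq g.
Proof.
move=> rP g /minimal_bad[m [mbad mmin]].
have m_neq0 n : m n <> [::].
  by move=> mn; apply: (mbad n n.+1) => //; rewrite mn; constructor.
have /choice[a aP] n : exists x, m n = x :: behead (m n).
  by case: (m n) (m_neq0 n) => // x v _; exists x.
have [h [hh ha]] := rP a.
pose g' n := if (n < h 0%N)%N then m n else behead (m (h (n - h 0%N)%N)).
have g'bad : badseq g'.
  move=> i j ij; rewrite /g'; case: (ltnP i) => hi; case: (ltnP j) => hj.
  - exact: mbad.
  - have ih : (i < h (j - h 0%N))%N.
      apply: leq_trans hi _; case: (j - _)%N => // k; exact/ltnW/hh.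
    by move=> e; apply: (mbad _ _ ih); rewrite (aP (h _)); exact: emb_skip.
  - by move: (leq_ltn_trans hi (ltn_trans ij hj)); rewrite ltnn.
  - have ij' : (i - h 0%N < j - h 0%N)%N by rewrite ltn_sub2r // (leq_ltn_trans hi).
    move=> e; apply: (mbad _ _ (hh _ _ ij')); rewrite (aP (h (i - _)%N)) (aP (h (j - _)%N)).
    by apply: emb_cons => //; exact: ha.
(* At h 0 the term of [g'] is the tail of that of [m], one letter shorter, against minimality. *)
have := mmin (h 0%N) g' g'bad.
rewrite {2}/g' ltnn subnn {1}aP /= ltnn => absurd.
by apply: notF; apply: absurd => k kh; rewrite /g' kh.
Qed.

End Higman.

(** Otherwise one could go on forever choosing elements of P that lie above none of the earlier
    choices, and the choices would form a bad sequence. *)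
Lemma finite_basis (A : eqType) (r : A -> A -> Prop) (P : A -> Prop) :
  (forall g, ~ bad r g) -> exists B : seq A,
    (forall x, x \in B -> P x) /\
    (forall y, P y -> exists2 x, x \in B & r x y).
Proof.
move=> rgood; apply: contrapT => noB.
have step (B : seq A) : exists y, (forall x, x \in B -> P x) ->
    P y /\ forall x, x \in B -> ~ r x y.
  have [BP|nBP] := pselect (forall x, x \in B -> P x); last first.
    have [[y _]|noA] := pselect (exists y : A, True); first by exists y.
    by case: nBP; case: B => // x B; case: noA; exists x.
  apply: contrapT => noy; apply: noB; exists B; split=> // y Py.
  apply: contrapT => noz; apply: noy; exists y => _; split=> // x xB rxy.
  by apply: noz; exists x.
have [f fP] := choice step.
pose l := fix l n := if n is n'.+1 then f (l n') :: l n' else [::].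
have lP n x : x \in l n -> P x.
  elim: n x => //= n IH x; rewrite inE => /predU1P[->|/IH//].
  by case: (fP _ IH).
have lin i j : (i < j)%N -> f (l i) \in l j.
  elim: j => //= j IH; rewrite ltnS leq_eqVlt inE => /predU1P[->|/IH->].
    by rewrite eqxx.
  by rewrite orbT.
by apply: (rgood (f \o l)) => i j /lin ij; case: (fP _ (lP j)) => _; apply.
Qed.

(** * Words, their order, and the monomials they denote *)

(* The word [:: (a_0, b_0); ...; (a_n, b_n)] stands for the monomial           *)
(* \prod_k p_k ^+ a_k * q_k ^+ b_k.                                            *)
Definition word : Type := seq (nat * nat).

HB.instance Definition _ := Choice.on word.

Definition pair_le (x y : nat * nat) : Prop := (x.1 <= y.1)%N /\ (x.2 <= y.2)%N.

Definition pair_lt (x y : nat * nat) : bool :=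
  (x.1 < y.1)%N || (x.1 == y.1) && (x.2 < y.2)%N.

(* Only words of the same length are compared; the last letter is the most     *)
(* significant one.                                                            *)
Fixpoint lt_word (u v : word) : bool :=
  match u, v with
  | x :: u', y :: v' => lt_word u' v' || (u' == v') && pair_lt x y
  | _, _ => false
  end.

Lemma pair_lt_total x y : [|| x == y, pair_lt x y | pair_lt y x].
Proof.
case: x y => a b [c d]; rewrite /pair_lt xpair_eqE /=.
by case: (ltngtP a c) => //= _; case: (ltngtP b d).
Qed.

Lemma pair_ltD d x y :
  pair_lt x y -> pair_lt (d.1 + x.1, d.2 + x.2)%N (d.1 + y.1, d.2 + y.2)%N.
Proof. by rewrite /pair_lt /= !ltn_add2l eqn_add2l. Qed.

Lemma pair_lt_trans : transitive pair_lt.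
Proof.
move=> [a b] [c d] [e f]; rewrite /pair_lt /=.
case/orP=> [ca|/andP[/eqP-> db]] /orP[ae|/andP[/eqP<- bf]].
- by rewrite (ltn_trans ca).
- by rewrite ca.
- by rewrite ae.
- by rewrite eqxx (ltn_trans db) ?orbT.
Qed.

Lemma pair_lt_wf x : Acc pair_lt x.
Proof.
case: x => a; elim/ltn_ind: a => a IHa b; elim/ltn_ind: b => b IHb.
constructor=> -[c d]; rewrite /pair_lt /= => /orP[ca|/andP[/eqP-> db]].
  exact: IHa.
exact: IHb.
Qed.

(** A lexicographic product: induction on the tail, the more significant part, and then on the head
    letter. *)
Lemma lt_word_wf u : Acc lt_word u.
Proof.
elim: u => [|x u IHu]; first by constructor=> -[].
elim: IHu x => {}u _ IHu x; elim: (pair_lt_wf x) => {}x _ IHx.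
constructor=> -[//|y v] /= /orP[vu|/andP[/eqP-> yx]]; first exact: IHu.
exact: IHx.
Qed.

Lemma lt_word_trans : transitive lt_word.
Proof.
elim=> [|y v IH] [|x u] [|z w] //=.
case/orP=> [uv|/andP[/eqP-> xy]] /orP[vw|/andP[/eqP<- yz]].
- by rewrite (IH _ _ uv).
- by rewrite uv.
- by rewrite vw.
- by rewrite eqxx (pair_lt_trans xy yz) orbT.
Qed.

Lemma lt_word_total u v : size u = size v -> [|| u == v, lt_word u v | lt_word v u].
Proof.
elim: u v => [|x u IH] [|y v] //= [/IH/or3P[/eqP->|->|->]]; rewrite ?orbT //.
rewrite eqxx /= eqseq_cons eqxx andbT.
by case/or3P: (pair_lt_total x y) => ->; rewrite ?orbT.
Qed.

Lemma lt_word_size u v : lt_word u v -> size u = size v.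
Proof.
by elim: u v => [|x u IH] [|y v] //= /orP[/IH->|/andP[/eqP->]].
Qed.

Lemma word_max (s : seq word) n :
  s != [::] -> (forall w, w \in s -> size w = n) ->
  exists2 u, u \in s & forall w, w \in s -> (w == u) || lt_word w u.
Proof.
elim: s => // u s IH _ sn; have un : size u = n by apply: sn; rewrite mem_head.
have [->|s0] := eqVneq s [::].
  by exists u => [|w]; rewrite inE // => ->.
have [w ws|v vs vmax] := IH s0; first by apply: sn; rewrite inE ws orbT.
have /or3P[/eqP uv|uv|vu] : [|| u == v, lt_word u v | lt_word v u].
- by apply: lt_word_total; rewrite un sn // inE vs orbT.
- exists v => [|w]; rewrite inE ?vs ?orbT //.
  by rewrite uv => /predU1P[->|/vmax//]; rewrite eqxx.
- exists v => [|w]; rewrite inE ?vs ?orbT //.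
  by case/predU1P=> [->|/vmax//]; rewrite uv orbT.
exists u => [|w]; rewrite inE ?eqxx // => /predU1P[->|/vmax]; first by rewrite eqxx.
by case/predU1P=> [->|wv]; rewrite ?vu ?orbT // (lt_word_trans wv vu) orbT.
Qed.

Section Monomial.
Context (K : fieldType).

(** The weight [c] reads an exponent off a letter: [fst] for powers of p_k, [snd] for powers of q_k,
    their total where a single eigenvalue acts. *)
Fixpoint monom (c : nat * nat -> nat) (P : nat -> K) (w : word) : K :=
  if w is e :: w' then P 0%N ^+ c e * monom c (P \o S) w' else 1.

Definition additive_weight (c : nat * nat -> nat) : Prop :=
  forall x y, c (x.1 + y.1, x.2 + y.2)%N = (c x + c y)%N.

Lemma eq_monom c c' P Q w : c =1 c' -> P =1 Q -> monom c P w = monom c' Q w.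
Proof.
move=> cc'; elim: w P Q => //= e w IH P Q PQ; rewrite PQ cc'; congr (_ * _).
by apply: IH => k /=.
Qed.

Fixpoint word_add (u v : word) : word :=
  match u, v with
  | x :: u', y :: v' => (x.1 + y.1, x.2 + y.2)%N :: word_add u' v'
  | [::], _ => v
  | _, [::] => u
  end.

Lemma monom_add c P u v : additive_weight c ->
  monom c P (word_add u v) = monom c P u * monom c P v.
Proof.
move=> cD; elim: u v P => [|x u IH] [|y v] P /=; rewrite ?mul1r ?mulr1 //.
by rewrite cD IH exprD; ring.
Qed.

Lemma monom_var c P k x : c (0, 0)%N = 0%N ->
  monom c P (rcons (nseq k (0, 0)%N) x) = P k ^+ c x.
Proof.
move=> c0; elim: k P => [|k IH] P /=; first by rewrite mulr1.
by rewrite c0 expr0 mul1r IH.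
Qed.

Lemma monom_pad c P w k : c (0, 0)%N = 0%N ->
  monom c P (w ++ nseq k (0, 0)%N) = monom c P w.
Proof.
move=> c0; elim: w P => [|e w IH] P /=; last by rewrite IH.
by elim: k P => //= k IH P; rewrite c0 expr0 mul1r IH.
Qed.

(* On monomials, t is the shift y_k -> y_(phi k) followed by multiplication by d. *)
Lemma emb_shift u v : emb pair_le u v ->
  exists (phi : nat -> nat) (d : word) (t : word -> word),
    [/\ t u = v,
        forall w, lt_word w u -> lt_word (t w) v,
        forall w, size w = size u -> size (t w) = size v &
        forall c P w, additive_weight c -> size w = size u ->
          monom c P (t w) = monom c P d * monom c (P \o phi) w].
Proof.
elim=> {u v} [v|y u v _ [phi [d [t [tu tlt tsz tm]]]]|].
- exists id, v, (fun=> v); split=> // [[]//|c P [|//] _ _ /=].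
  by rewrite mulr1.
- exists (S \o phi), ((y : nat * nat) :: d), (fun w => y :: t w).
  split=> [|w wu|w wu|c P w cD wu] /=; rewrite ?tu ?tlt ?tsz ?tm //.
  by rewrite mulrA.
move=> x y u v [xy1 xy2] _ [phi [d [t [tu tlt tsz tm]]]].
(* The quotient letter, which multiplies x to y; it enters both [d] and [t]. *)
pose e := (y.1 - x.1, y.2 - x.2)%N.
pose phi' k := if k is k'.+1 then (phi k').+1 else 0%N.
pose t' (w : word) : word :=
  if w is z :: w' then (e.1 + z.1, e.2 + z.2)%N :: t w' else [::].
have ey : (e.1 + x.1, e.2 + x.2)%N = y by rewrite /= !subnK //; case: (y).
exists phi', (e :: d), t'; split.
- by rewrite /t' tu ey.
- move=> [//|z w] /= /orP[/tlt->//|/andP[/eqP-> zx]]; rewrite tu eqxx /=.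
  by have := pair_ltD e zx; rewrite ey /= => ->; rewrite orbT.
- by move=> [|z w] //= [/tsz->].
- move=> c P [//|z w] cD [wu].
  have /= ce := cD e z; rewrite /= ce exprD tm //=.
  rewrite (@eq_monom c c (P \o phi' \o S) (P \o S \o phi)) //; ring.
Qed.

End Monomial.

Lemma word_good g : ~ bad (emb pair_le) g.
Proof. by apply: higman; exact: perfect_pair perfect_leq perfect_leq. Qed.

(** * Submodules given as sets *)

Record is_submodule (K : fieldType) (V : lmodType K) (A : set V) : Prop := {
  submodule0 : A 0;
  submodule_lin : forall a x y, A x -> A y -> A (a *: x + y)
}.

Section Submodule.
Context (K : fieldType) (V : lmodType K) (A : set V) (subA : is_submodule A).

Lemma submoduleD x y : A x -> A y -> A (x + y).
Proof. by rewrite -{2}[x]scale1r; exact: submodule_lin. Qed.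

Lemma submoduleZ a x : A x -> A (a *: x).
Proof. by move=> Ax; rewrite -[_ *: _]addr0; apply: submodule_lin (submodule0 _). Qed.

Lemma submoduleB x y : A x -> A y -> A (x - y).
Proof. by move=> Ax Ay; rewrite addrC -scaleN1r; exact: submodule_lin. Qed.

Lemma submodule_subr x y : A (x - y) -> A y -> A x.
Proof. by move=> Axy Ay; rewrite -(subrK y x); exact: submoduleD. Qed.

Lemma submodule_subl x y : A (x - y) -> A x -> A y.
Proof. by move=> Axy Ax; rewrite -(subKr x y); exact: submoduleB. Qed.

Lemma submodule_sum (T : eqType) (s : seq T) (F : T -> V) :
  (forall x, x \in s -> A (F x)) -> A (\sum_(x <- s) F x).
Proof.
move=> sF; rewrite big_seq; elim/big_rec: _ => [|x y xs]; first exact: submodule0.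
exact/submoduleD/sF.
Qed.

End Submodule.

(** * Finite bases by reduction of leading words *)

(* A Groebner basis argument: the leading words of J have a finite basis for   *)
(* emb by Higman's lemma, and lt_word allows reduction modulo J'.              *)
Section Noether.
Context (K : fieldType) (V : lmodType K) (I : eqType) (mon : I -> word -> V).

Definition comb i (l : seq (K * word)) : V := \sum_(x <- l) x.1 *: mon i x.2.

Lemma comb_filter i l u :
  comb i l = (\sum_(x <- l | x.2 == u) x.1) *: mon i u
             + comb i [seq x <- l | x.2 != u].
Proof.
rewrite /comb big_filter (bigID (fun x => x.2 == u)) /= scaler_suml.
by congr (_ + _); apply: eq_bigr => x /eqP->.
Qed.

Lemma comb_scale i a l : comb i [seq (a * x.1, x.2) | x <- l] = a *: comb i l.
Proof.
by rewrite /comb big_map scaler_sumr; apply: eq_bigr => x _; rewrite scalerA.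
Qed.

Lemma comb_cat i l1 l2 : comb i (l1 ++ l2) = comb i l1 + comb i l2.
Proof. by rewrite /comb big_cat. Qed.

Context (stable : set V -> Prop).
Context (stable_sub : forall J, stable J -> is_submodule J).
Context (stable_shift : forall i i' u v, emb pair_le u v ->
  exists (T : {linear V -> V}) (t : word -> word),
    [/\ t u = v, forall w, lt_word w u -> lt_word (t w) v,
        forall J, stable J -> forall x, J x -> J (T x) &
        forall J, stable J -> forall w, size w = size u ->
          J (T (mon i w) - mon i' (t w))]).

(** Leading words belong to formal combinations rather than to vectors, so the [mon i w] may be
    dependent. The relation [r] compares words only, since [stable_shift] carries any index to any
    other. *)
Lemma stable_finite_basis J : stable J -> exists S : seq V,
  (forall x, x \in S -> J x) /\
  forall J', stable J' -> (forall x, x \in S -> J' x) ->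
    forall n i l, (forall x, x \in l -> size x.2 = n) ->
      J (comb i l) -> J' (comb i l).
Proof.
move=> Jst.
pose lead (y : I * word) l :=
  (forall x, x \in l -> lt_word x.2 y.2) /\ J (mon y.1 y.2 + comb y.1 l).
pose r (x y : I * word) := emb pair_le x.2 y.2.
have [B [BP Bbase]] : exists B : seq (I * word),
    (forall x, x \in B -> exists l, lead x l) /\
    forall y, (exists l, lead y l) -> exists2 x, x \in B & r x y.
  by apply: finite_basis => g gbad; exact: (@word_good (snd \o g)).
have /choice[L LP] y : exists l, y \in B -> lead y l.
  by have [/BP[l yl]|_] := boolP (y \in B); [exists l|exists [::]].
exists [seq mon y.1 y.2 + comb y.1 (L y) | y <- B]; split=> [_ /mapP[y yB ->]|].
  by case: (LP y yB).
move=> J' J'st SJ'.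
have subJ := stable_sub Jst; have subJ' := stable_sub J'st.
(* Induction on a bound u for the words of l: a shifted basis element cancels the term at u and
   leaves smaller words. *)
have main u : forall i l, (forall x, x \in l -> (x.2 == u) || lt_word x.2 u) ->
    J (comb i l) -> J' (comb i l).
  elim: (lt_word_wf u) => {}u _ IH i l lu Jl.
  have low l' : (forall x, x \in l' -> lt_word x.2 u) ->
      J (comb i l') -> J' (comb i l').
    move=> l'u; have [->|l'0] := eqVneq l' [::].
      by rewrite /comb big_nil => _; exact: submodule0.
    have [||v /mapP[x xl' ->] vmax] := @word_max (unzip2 l') (size u).
    - by case: (l') l'0.
    - by move=> w /mapP[x /l'u xu ->]; exact: lt_word_size.
    by apply: IH (l'u _ xl') _ _ _ => y yl'; apply/vmax/map_f.
  rewrite (comb_filter i l u); set c := \sum_(_ <- _ | _) _; set l2 := filter _ _.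
  have l2u x : x \in l2 -> lt_word x.2 u.
    by rewrite mem_filter => /andP[/negPf xu /lu]; rewrite xu.
  have Jl2 : J (c *: mon i u + comb i l2) by rewrite -comb_filter.
  have [c0|c0] := eqVneq c 0.
    by move: Jl2; rewrite c0 scale0r add0r; exact: low.
  (* Divided by its coefficient c at u, the combination exhibits (i, u) as a leading word of J. *)
  have [|[i0 u0] yB ry] := Bbase (i, u).
    exists [seq (c^-1 * x.1, x.2) | x <- l2]; split=> [_ /mapP[x /l2u xu ->] //|/=].
    rewrite comb_scale -[X in X + _](scalerK c0) -scalerDr.
    exact: submoduleZ.
  have [l0u Jl0] := LP _ yB; set l0 := L _ in l0u Jl0.
  have [T [t [tu tlt TJ Tt]]] := stable_shift i0 i ry.
  (* The shifted basis element, written with the words [t x.2]; it agrees with the image under [T]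
     modulo J and modulo J' alike. *)
  set y := (i0, u0) in Jl0 l0u *; pose g := mon i u + comb i [seq (x.1, t x.2) | x <- l0].
  have Tg M : stable M -> M (T (mon i0 u0 + comb i0 l0) - g).
    move=> Mst; have subM := stable_sub Mst.
    rewrite linearD opprD addrACA; apply: (submoduleD subM).
      by rewrite -[u]tu; exact: Tt.
    rewrite /comb big_map linear_sum -sumrB; apply: submodule_sum => // x xl0.
    rewrite linearZ /= -scalerBr; apply: (submoduleZ subM); apply: (Tt M Mst).
    exact: lt_word_size (l0u _ xl0).
  have Jg : J g by apply: submodule_subl (Tg J Jst) _ => //; exact: TJ.
  have J'g : J' g.
    apply: submodule_subl (Tg J' J'st) _ => //; apply: TJ => //.
    by apply: SJ'; apply/mapP; exists y.
  (* What is left after subtracting [c *: g]: the terms at u cancel and all remaining words lie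
     below u. *)
  pose l3 := l2 ++ [seq (- c * x.1, x.2) | x <- [seq (x.1, t x.2) | x <- l0]].
  have l3E : c *: mon i u + comb i l2 = c *: g + comb i l3.
    by rewrite /l3 comb_cat comb_scale scaleNr /g scalerDr addrCA -addrA subrr addr0 addrC.
  rewrite l3E; apply: submodule_lin => //; apply: low; last first.
    have -> : comb i l3 = c *: mon i u + comb i l2 - c *: g by rewrite l3E addrC addKr.
    by apply: submoduleB => //; exact: submoduleZ.
  move=> x; rewrite mem_cat => /orP[/l2u//|/mapP[z /mapP[z0 /l0u z0u ->] ->]] /=.
  exact: tlt.
move=> n i l ln Jl; have [->|l0] := eqVneq l [::].
  by rewrite /comb big_nil; exact: submodule0.
have [||v _ vmax] := @word_max (unzip2 l) n.
- by case: (l) l0.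
- by move=> w /mapP[x /ln xn ->].
by apply: (main v) => // x xl; apply/vmax/map_f.
Qed.

End Noether.

(** * Coordinates on upper triangular matrices *)

Section UpperTriangular.
Context (K : fieldType).

(** The diagonal is (a, b, c), and x, y, z are the coefficients of e12, e23, e13 in this order. *)
Definition ut3_rows (a b c x y z : K) : 'M[K]_3 :=
  \matrix_(i < 3, j < 3)
    nth 0 (nth [::] [:: [:: a; x; z]; [:: 0; b; y]; [:: 0; 0; c]] i) j.

Lemma ut3_rows_upper a b c x y z : ut3_rows a b c x y z \is a upper3 K.
Proof. by apply/upper3P => -[[|[|[|//]]] ?] [[|[|[|//]]] ?]; rewrite mxE. Qed.

Definition ut3 a b c x y z : UT3 K := MkUT3 (ut3_rows_upper a b c x y z).

Lemma ut3_lin k a b c x y z a' b' c' x' y' z' :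
  k *: ut3 a b c x y z + ut3 a' b' c' x' y' z' =
  ut3 (k * a + a') (k * b + b') (k * c + c') (k * x + x') (k * y + y') (k * z + z').
Proof.
apply: val_inj; apply/matrixP => -[[|[|[|//]]] ?] [[|[|[|//]]] ?];
  by rewrite !mxE /= ?mulr0 ?addr0.
Qed.

Lemma ut3_0 : ut3 0 0 0 0 0 0 = 0.
Proof.
by apply: val_inj; apply/matrixP => -[[|[|[|//]]] ?] [[|[|[|//]]] ?]; rewrite !mxE.
Qed.

Lemma ut3_eq0 a b c x y z : a = 0 -> b = 0 -> c = 0 -> x = 0 -> y = 0 -> z = 0 ->
  ut3 a b c x y z = 0.
Proof. by do 6!move=> ->; exact: ut3_0. Qed.

Lemma ut3Z k a b c x y z :
  k *: ut3 a b c x y z = ut3 (k * a) (k * b) (k * c) (k * x) (k * y) (k * z).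
Proof. by rewrite -[LHS]addr0 -ut3_0 ut3_lin !addr0. Qed.

Lemma ut3B a b c x y z a' b' c' x' y' z' :
  ut3 a b c x y z - ut3 a' b' c' x' y' z' =
  ut3 (a - a') (b - b') (c - c') (x - x') (y - y') (z - z').
Proof. by rewrite addrC -scaleN1r ut3_lin; congr ut3; rewrite mulN1r addrC. Qed.

Lemma ut3_lie a b c x y z a' b' c' x' y' z' :
  lie (ut3 a b c x y z) (ut3 a' b' c' x' y' z') =
  ut3 0 0 0 ((a - b) * x' - (a' - b') * x) ((b - c) * y' - (b' - c') * y)
    ((a - c) * z' - (a' - c') * z + x * y' - x' * y).
Proof.
apply: val_inj; apply/matrixP => -[[|[|[|//]]] ?] [[|[|[|//]]] ?];
  rewrite !mxE !big_ord_recl !big_ord0 !mxE /=; ring.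
Qed.

Lemma ut3_eta (A : UT3 K) :
  A = ut3 (A 0 0) (A 1 1) (A ord_max ord_max) (A 0 1) (A 1 ord_max) (A 0 ord_max).
Proof.
apply: val_inj; apply/matrixP => i j.
case: i j => -[|[|[|//]]] hi [] [|[|[|//]]] hj; rewrite !mxE /=;
  first [by congr (_ _ _); apply: val_inj | by have /upper3P -> := valP A].
Qed.

End UpperTriangular.

(** * Graded homomorphisms to UT3 as points with scalar coordinates *)

Section Valuation.
Context (K : fieldType) (G : zmodType) (e1 e2 : G).
Local Notation L := (free_graded_lie K G).

(** When e1, e2 form a basis the four degrees are distinct ([support_neq]), so at most one test
    succeeds. *)
Definition on_support (T : Type) (y z w u : nat -> T) (o : T) (x : nat * G) : T :=
  if x.2 == 0 then y x.1 else if x.2 == e1 then z x.1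
  else if x.2 == e2 then w x.1 else if x.2 == e1 + e2 then u x.1 else o.

(* A graded homomorphism to UT3 is a choice of y_i -> diag (a_i, b_i, c_i) in  *)
(* degree 0, z_i -> s_i e12 in degree e1, w_i -> t_i e23 in degree e2 and      *)
(* u_i -> r_i e13 in degree e1 + e2.                                           *)
Record coords := Coords {
  pa : nat -> K; pb : nat -> K; pc : nat -> K;
  ps : nat -> K; pt : nat -> K; pr : nat -> K
}.

Definition assignment (v : coords) : nat * G -> UT3 K :=
  on_support (fun i => ut3 (pa v i) (pb v i) (pc v i) 0 0 0)
    (fun i => ut3 0 0 0 (ps v i) 0 0) (fun i => ut3 0 0 0 0 (pt v i) 0)
    (fun i => ut3 0 0 0 0 0 (pr v i)) 0.

Definition ev (v : coords) : L -> UT3 K := fl_lift (assignment v).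
HB.instance Definition _ v := GRing.Linear.on (ev v).

Lemma ev_lie v x y : ev v (lie x y) = lie (ev v x) (ev v y).
Proof. exact: fl_lift_lie. Qed.

Context (basis12 : free_abelian_basis2 e1 e2).

Lemma basis2_neq (m n m' n' : int) : (m, n) != (m', n') ->
  e1 *~ m + e2 *~ n != e1 *~ m' + e2 *~ n'.
Proof.
apply: contra => /eqP mn; apply/eqP.
exact: (@bij_inj _ _ _ basis12 (m, n) (m', n') mn).
Qed.

Lemma support_neq : [/\ e1 != 0, e2 != 0, e1 + e2 != 0
  & [/\ e2 != e1, e1 + e2 != e1 & e1 + e2 != e2]].
Proof.
split; last split.
- by have := @basis2_neq 1 0 0 0 isT; rewrite !(mulr1z, mulr0z, addr0, add0r).
- by have := @basis2_neq 0 1 0 0 isT; rewrite !(mulr1z, mulr0z, addr0, add0r).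
- by have := @basis2_neq 1 1 0 0 isT; rewrite !(mulr1z, mulr0z, addr0, add0r).
- by have := @basis2_neq 0 1 1 0 isT; rewrite !(mulr1z, mulr0z, addr0, add0r).
- by have := @basis2_neq 1 1 1 0 isT; rewrite !(mulr1z, mulr0z, addr0, add0r).
- by have := @basis2_neq 1 1 0 1 isT; rewrite !(mulr1z, mulr0z, addr0, add0r).
Qed.

Lemma on_supportE (T : Type) (y z w u : nat -> T) o i :
  [/\ on_support y z w u o (i, 0) = y i, on_support y z w u o (i, e1) = z i,
      on_support y z w u o (i, e2) = w i & on_support y z w u o (i, e1 + e2) = u i].
Proof.
have [/negPf e10 /negPf e20 /negPf e120 [/negPf e21 /negPf e121 /negPf e122]] := support_neq.
by split; rewrite /on_support /= ?e10 ?e20 ?e120 ?e21 ?e121 ?e122 ?eqxx.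
Qed.

Lemma assignment_comp v x : ut3_comp e1 e2 x.2 (assignment v x).
Proof.
rewrite /assignment /on_support -ut3_0.
by do 4?[case: ifP => [/eqP->|_]] => -[[|[|[|//]]] ?] [[|[|[|//]]] ?];
  rewrite mxE /= ?eqxx.
Qed.

(** The (i, j) entry of [sigma (k, d)] vanishes unless e_ij has degree d; as the four degrees are
    distinct, only the entries recorded in [coords] survive. *)
Lemma comp_assignment (sigma : nat * G -> UT3 K) :
  (forall x, ut3_comp e1 e2 x.2 (sigma x)) -> exists v, sigma =1 assignment v.
Proof.
move=> sc.
pose e i j d k := (sigma (k, d) : 'M[K]_3) i j.
exists (Coords (e 0 0 0) (e 1 1 0) (e ord_max ord_max 0) (e 0 1 e1)
  (e 1 ord_max e2) (e 0 ord_max (e1 + e2))) => -[k d].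
have e0 i j : ut3_deg e1 e2 i j != d -> e i j d k = 0.
  by move=> hd; apply/eqP; apply: contraNT hd => /(sc (k, d)) ->.
have [/negPf e10 /negPf e20 /negPf e120 [/negPf e21 /negPf e121 /negPf e122]] := support_neq.
rewrite [LHS]ut3_eta -!/(e _ _ d k) /assignment /on_support /=.
case: (eqVneq d 0) e0 => [->|d0] e0.
  by congr ut3; apply: e0; rewrite /ut3_deg /= ?e10 ?e20 ?e120.
case: (eqVneq d e1) e0 => [->|d1] e0.
  by congr ut3; apply: e0; rewrite /ut3_deg /= ?e21 ?e121 1?eq_sym ?e10.
case: (eqVneq d e2) e0 => [->|d2] e0.
  by congr ut3; apply: e0; rewrite /ut3_deg /= ?e122 1?eq_sym ?e20 ?e21.
case: (eqVneq d (e1 + e2)) e0 => [->|d3] e0.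
  by congr ut3; apply: e0; rewrite /ut3_deg /= 1?eq_sym ?e120 ?e121 ?e122.
by rewrite -ut3_0; congr ut3; apply: e0; rewrite /ut3_deg /= 1?eq_sym.
Qed.

End Valuation.

(** * Homomorphisms out of the free Lie algebra, and generation by brackets with variables *)

Section Lifting.
Context (K : fieldType) (G : zmodType).
Local Notation L := (free_graded_lie K G).

Lemma fl_lift_graded (M : lieAlgType K) (cM : G -> set M)
    (sigma : nat * G -> M) :
  (forall g, is_submodule (cM g)) ->
  (forall g h x y, cM g x -> cM h y -> cM (g + h) (lie x y)) ->
  (forall x, cM x.2 (sigma x)) ->
  graded_hom (@free_comp K G) cM (fl_lift sigma).
Proof.
move=> cM_sub cM_lie sc; split; first exact: fl_lift_lie.
move=> g x /=; elim=> {g x} [i g|g|g a x y _ IHx _ IHy|g h x y _ IHx _ IHy].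
- by rewrite fl_lift_var; exact: (sc (i, g)).
- by rewrite linear0; exact: submodule0.
- by rewrite linearP; exact: submodule_lin.
- by rewrite fl_lift_lie; exact: cM_lie.
Qed.

Lemma free_comp_submodule g : is_submodule (@free_comp K G g).
Proof. by split; [exact: free_comp_0 | exact: free_comp_lin]. Qed.

Lemma fl_endo_graded (tau : nat * G -> L) :
  (forall x, free_comp x.2 (tau x)) ->
  graded_hom (@free_comp K G) (@free_comp K G) (fl_lift tau).
Proof.
apply: fl_lift_graded; [exact: free_comp_submodule | exact: free_comp_lie].
Qed.

Lemma fl_lift_comp (M : lieAlgType K) (sigma sigma' : nat * G -> M)
    (tau : nat * G -> L) :
  (forall x, fl_lift sigma (tau x) = sigma' x) ->
  forall f, fl_lift sigma (fl_lift tau f) = fl_lift sigma' f.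
Proof.
move=> st; apply: (@fl_lift_unique _ _ _ sigma' (fl_lift sigma \o fl_lift tau)).
  by move=> x y /=; rewrite !fl_lift_lie.
by move=> i /=; rewrite fl_lift_var.
Qed.

Section LieFacts.
Context (M : lieAlgType K).
Implicit Types x y z : M.

Lemma lieDl x y z : lie (x + y) z = lie x z + lie y z.
Proof. by have := @lie_linearl K M z 1 x y; rewrite !scale1r. Qed.

Lemma lieDr x y z : lie x (y + z) = lie x y + lie x z.
Proof. by have := @lie_linearr K M x 1 y z; rewrite !scale1r. Qed.

Lemma lie0l z : lie 0 z = 0.
Proof. by apply: (addrI (lie 0 z)); rewrite -lieDl !addr0. Qed.

Lemma lie0r x : lie x 0 = 0.
Proof. by apply: (addrI (lie x 0)); rewrite -lieDr !addr0. Qed.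

Lemma lieZl a x z : lie (a *: x) z = a *: lie x z.
Proof. by have := @lie_linearl K M z a x 0; rewrite lie0l !addr0. Qed.

Lemma lieZr a x z : lie x (a *: z) = a *: lie x z.
Proof. by have := @lie_linearr K M x a z 0; rewrite lie0r !addr0. Qed.

Lemma lieC x y : lie x y = - lie y x.
Proof.
apply/eqP; rewrite -addr_eq0; apply/eqP; have := liexx (x + y).
by rewrite lieDl !lieDr !liexx add0r addr0.
Qed.

Lemma lie_br x y z : lie (lie x y) z = lie x (lie y z) - lie y (lie x z).
Proof.
rewrite lieC [lie x z]lieC -[- lie z x]scaleN1r lieZr scaleN1r opprK.
by apply/eqP; rewrite eq_sym -addr_eq0 lie_jacobi.
Qed.

End LieFacts.

Local Notation cl := (@fl_class K (nat * G) : _ -> L).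

Lemma fl_class0 : cl LZero = 0. Proof. by []. Qed.

Lemma fl_classN s : cl (LOpp s) = - cl s.
Proof. by rewrite -fl_oppE. Qed.

Lemma fl_classD s t : cl (LAdd s t) = cl s + cl t.
Proof. by rewrite -fl_addE. Qed.

Lemma fl_classZ a s : cl (LScale a s) = a *: cl s.
Proof. by rewrite -fl_scaleE. Qed.

Lemma fl_class_lie s t : cl (LBr s t) = lie (cl s) (cl t).
Proof. by rewrite -fl_brE. Qed.

(* By the Jacobi identity, the elements whose adjoint action preserves W form  *)
(* a subalgebra.                                                               *)
Lemma fl_generate (W : set L) : is_submodule W ->
  (forall x, W (fl_var K x)) -> (forall x f, W f -> W (lie (fl_var K x : L) f)) ->
  forall f, W f.
Proof.
move=> subW Wvar Wlie.
have ad f : forall g, W g -> W (lie f g).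
  elim/fl_ind: f; elim=> [i||s IHs|s IHs t IHt|a s IHs|s IHs t IHt] g Wg.
  - exact: Wlie.
  - by rewrite fl_class0 lie0l; exact: submodule0.
  - rewrite fl_classN -scaleN1r lieZl.
    exact/(submoduleZ subW)/IHs.
  - rewrite fl_classD lieDl.
    by apply: (submoduleD subW); [exact: IHs | exact: IHt].
  - rewrite fl_classZ lieZl.
    exact/(submoduleZ subW)/IHs.
  - rewrite fl_class_lie lie_br.
    by apply: (submoduleB subW); [exact/IHs/IHt | exact/IHt/IHs].
elim/fl_ind; elim=> [i||s IHs|s IHs t IHt|a s IHs|s IHs t IHt].
- exact: Wvar.
- by rewrite fl_class0; exact: submodule0.
- by rewrite fl_classN -scaleN1r; exact: submoduleZ.
- by rewrite fl_classD; exact: submoduleD.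
- by rewrite fl_classZ; exact: submoduleZ.
- by rewrite fl_class_lie; exact: ad.
Qed.

End Lifting.

(** * Constructions of T_G-ideals *)

Section TGIdeals.
Context (K : fieldType) (G : zmodType).
Local Notation L := (free_graded_lie K G).

Lemma TG_ideal_submodule (J : set L) : is_TG_ideal J -> is_submodule J.
Proof. by move=> TJ; split; [exact: TG_ideal0 | exact: TG_ideal_lin]. Qed.

Lemma TG_ideal_gen_TG (S : set L) : is_TG_ideal (TG_ideal_gen S).
Proof.
split=> [J [TJ _]|a x y Sx Sy J [TJ SJ]|x y Sy J [TJ SJ]|f fh x Sx J [TJ SJ]].
- exact: TG_ideal0.
- by apply: TG_ideal_lin => //; [exact: Sx | exact: Sy].
- by apply: TG_ideal_lie => //; exact: Sy.
- by apply: TG_ideal_endo => //; exact: Sx.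
Qed.

Lemma TG_ideal_sum (A B : set L) : is_TG_ideal A -> is_TG_ideal B ->
  is_TG_ideal [set u + v | u in A & v in B].
Proof.
move=> TA TB; split.
- by exists 0; [exact: TG_ideal0|exists 0; [exact: TG_ideal0|rewrite addr0]].
- move=> a _ _ [u Au [v Bv <-]] [u' Au' [v' Bv' <-]].
  exists (a *: u + u'); first exact: TG_ideal_lin.
  by exists (a *: v + v'); [exact: TG_ideal_lin|rewrite scalerDr addrACA].
- move=> x _ [u Au [v Bv <-]]; exists (lie x u); first exact: TG_ideal_lie.
  by exists (lie x v); [exact: TG_ideal_lie|rewrite lieDr].
- move=> f fh _ [u Au [v Bv <-]]; exists (f u); first exact: TG_ideal_endo.
  by exists (f v); [exact: TG_ideal_endo|rewrite linearD].
Qed.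

Lemma graded_identities_TG (M : lieAlgType K) (cM : G -> set M) :
  is_TG_ideal (graded_identities cM).
Proof.
split=> [phi _|a x y Ix Iy phi ph|x y Iy phi ph|f [flie fdeg] x Ix phi [plie pdeg]].
- exact: linear0.
- by rewrite linearP Ix // Iy // scaler0 addr0.
- by rewrite (graded_hom_lie ph) Iy // lie0r.
- apply: (Ix (phi \o f)); split=> [y z|g y cy] /=; first by rewrite flie plie.
  exact/pdeg/fdeg.
Qed.

End TGIdeals.

(** * Identities, substitutions and the action of the y's *)

Section Identities.
Context (K : fieldType) (G : zmodType) (e1 e2 : G).
Context (basis12 : free_abelian_basis2 e1 e2).
Local Notation L := (free_graded_lie K G).
Local Notation Id := (graded_identities (@ut3_comp K G e1 e2)).
Local Notation supp := (on_support e1 e2).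
Local Notation ev := (ev e1 e2).

Lemma ut3_comp_submodule d : is_submodule (@ut3_comp K G e1 e2 d).
Proof.
split=> [i j|a A B cA cB i j]; first by rewrite mxE eqxx.
rewrite !mxE; have [->|/cA//] := eqVneq (A i j) 0.
by rewrite mulr0 add0r => /cB.
Qed.

Lemma ut3_comp_lie d d' (A B : UT3 K) : ut3_comp e1 e2 d A ->
  ut3_comp e1 e2 d' B -> ut3_comp e1 e2 (d + d') (lie A B).
Proof.
have prod (a a' : G) (C D : UT3 K) i j : ut3_comp e1 e2 a C -> ut3_comp e1 e2 a' D ->
    ((C : 'M_3) *m (D : 'M_3)) i j != 0 -> ut3_deg e1 e2 i j = a + a'.
  move=> cC cD; rewrite mxE => CD.
  have [k] : exists k, C i k * D k j != 0.
    apply: contrapT => noK; case/eqP: CD; rewrite big1 // => k _.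
    by apply/eqP; apply: contrapT => CDk; apply: noK; exists k; exact/negP.
  rewrite mulf_eq0 negb_or => /andP[Cik Dkj].
  have ik : (i <= k)%N.
    by rewrite leqNgt; apply: contra Cik => ki; have /upper3P-> := valP C.
  have kj : (k <= j)%N.
    by rewrite leqNgt; apply: contra Dkj => jk; have /upper3P-> := valP D.
  rewrite -(cC _ _ Cik) -(cD _ _ Dkj).
  case: i j k ik kj {CD Cik Dkj} => -[|[|[|//]]] ? [[|[|[|//]]] ?] [[|[|[|//]]] ?] //=;
    by rewrite /ut3_deg /= ?addr0 ?add0r.
move=> cA cB i j.
have -> : (lie A B : UT3 K) i j =
    ((A : 'M_3) *m (B : 'M_3)) i j - ((B : 'M_3) *m (A : 'M_3)) i j.
  by rewrite [LHS]mxE [X in _ + X]mxE.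
have [->|AB _] := eqVneq (((A : 'M_3) *m (B : 'M_3)) i j) 0; last exact: prod AB.
by rewrite sub0r oppr_eq0 addrC; exact: prod.
Qed.

Lemma ev_graded v : graded_hom (@free_comp K G) (@ut3_comp K G e1 e2) (ev v).
Proof.
apply: fl_lift_graded; [exact: ut3_comp_submodule|exact: ut3_comp_lie|].
exact: assignment_comp.
Qed.

(** A graded homomorphism is determined by its values on the generators, and these form some
    [assignment]; conversely each [ev v] is graded. *)
Lemma identityP f : Id f <-> forall v, ev v f = 0.
Proof.
split=> [If v|ev0 phi [plie pdeg]]; first exact: (If (ev v) (ev_graded v)).
have [x|v pv] := comp_assignment basis12 (sigma := fun x => phi (fl_var K x)).
  by apply: pdeg; case: x => i g; exact: free_comp_var.
by rewrite (fl_lift_unique (v := assignment e1 e2 v) plie pv); exact: ev0.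
Qed.

Lemma identity_eq f g : (forall v, ev v f = ev v g) -> Id (f - g).
Proof. by move=> fg; apply/identityP => v; rewrite linearB /= fg subrr. Qed.

Definition endo (y z w u : nat -> L) : L -> L := fl_lift (supp y z w u 0).
HB.instance Definition _ y z w u := GRing.Linear.on (endo y z w u).

Lemma endo_graded y z w u :
  (forall i, free_comp 0 (y i)) -> (forall i, free_comp e1 (z i)) ->
  (forall i, free_comp e2 (w i)) -> (forall i, free_comp (e1 + e2) (u i)) ->
  graded_hom (@free_comp K G) (@free_comp K G) (endo y z w u).
Proof.
move=> cy cz cw cu; apply: fl_endo_graded => x; rewrite /on_support.
by do 4?[case: ifP => [/eqP->//|_]]; exact: free_comp_0.
Qed.

(** Substituting and then evaluating at v is evaluating at another point v'; this turns claims about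
    endomorphisms modulo identities into matrix computations. *)
Lemma ev_endo v v' y z w u :
  (forall i, ev v (y i) = ut3 (pa v' i) (pb v' i) (pc v' i) 0 0 0) ->
  (forall i, ev v (z i) = ut3 0 0 0 (ps v' i) 0 0) ->
  (forall i, ev v (w i) = ut3 0 0 0 0 (pt v' i) 0) ->
  (forall i, ev v (u i) = ut3 0 0 0 0 0 (pr v' i)) ->
  forall f, ev v (endo y z w u f) = ev v' f.
Proof.
move=> vy vz vw vu; apply: fl_lift_comp => x; rewrite /assignment /on_support.
by do 4?[case: ifP => _; [by first [exact: vy|exact: vz|exact: vw|exact: vu]|]];
  exact: (linear0 (fl_lift _)).
Qed.

Definition vY i : L := fl_var K (i, 0).
Definition vZ i : L := fl_var K (i, e1).
Definition vW i : L := fl_var K (i, e2).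
Definition vU i : L := fl_var K (i, e1 + e2).

Lemma ev_var v i :
  [/\ ev v (vY i) = ut3 (pa v i) (pb v i) (pc v i) 0 0 0,
      ev v (vZ i) = ut3 0 0 0 (ps v i) 0 0,
      ev v (vW i) = ut3 0 0 0 0 (pt v i) 0 &
      ev v (vU i) = ut3 0 0 0 0 0 (pr v i)].
Proof.
rewrite /ev !fl_lift_var /assignment.
have [-> -> -> ->] // := on_supportE basis12
  (fun i => ut3 (pa v i) (pb v i) (pc v i) 0 0 0) (fun i => ut3 0 0 0 (ps v i) 0 0)
  (fun i => ut3 0 0 0 0 (pt v i) 0) (fun i => ut3 0 0 0 0 0 (pr v i)) 0 i.
Qed.

(** The monomial of w in the operators ad y_k, ad y_(k+1), ..., applied to x. *)
Fixpoint adw (c : nat * nat -> nat) (k : nat) (w : word) (x : L) : L :=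
  if w is e :: w' then iter (c e) (lie (vY k)) (adw c k.+1 w' x) else x.

Lemma adw_comp c k w d x : free_comp d x -> free_comp d (adw c k w x).
Proof.
move=> dx; elim: w k => //= e w IH k; elim: (c e) => //= n IHn.
by rewrite -[d]add0r; apply: free_comp_lie => //; exact: free_comp_var.
Qed.

Definition eig12 (v : coords K) k := pa v k - pb v k.
Definition eig23 (v : coords K) k := pb v k - pc v k.
Definition eig13 (v : coords K) k := pa v k - pc v k.

(** The matrix units e12, e23, e13 are common eigenvectors of all ad y_i, with differences of
    diagonal entries as eigenvalues. *)
Lemma ev_adw v c k w x s t r : ev v x = ut3 0 0 0 s t r ->
  ev v (adw c k w x) =
  ut3 0 0 0 (monom c (fun i => eig12 v (k + i)) w * s)
    (monom c (fun i => eig23 v (k + i)) w * t) (monom c (fun i => eig13 v (k + i)) w * r).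
Proof.
move=> vx; elim: w k => [|e w IH] k /=; first by rewrite !mul1r.
have E P : monom c ((fun i => P (k + i)%N) \o S) w = monom c (fun i => P (k.+1 + i)%N) w :> K.
  by apply: eq_monom => // i /=; rewrite addSnnS.
rewrite addn0 !E -!mulrA; elim: (c e) => [|n IHn] /=; first by rewrite !expr0 !mul1r.
rewrite ev_lie IHn; have [-> _ _ _] := ev_var v k.
by rewrite ut3_lie /eig12 /eig23 /eig13 !exprS; congr ut3; ring.
Qed.

End Identities.

(** * Monomials spanning the free algebra modulo the identities *)

(* The multihomogeneous classes of the relatively free algebra: y_i, and       *)
(* z_i, w_i, u_i, [z_i, w_j] acted upon by the y's.  Distinct words may give   *)
(* the same monomial; linear independence is never used.                       *)
Inductive cls : Type :=
| cY of nat | cZ of nat | cW of nat | cU of nat | cZW of nat & nat.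

HB.instance Definition _ := gen_eqMixin cls.

Definition same_kind (c c' : cls) : bool :=
  match c, c' with
  | cY _, cY _ | cZ _, cZ _ | cW _, cW _ | cU _, cU _ | cZW _ _, cZW _ _ => true
  | _, _ => false
  end.

Definition wt (e : nat * nat) : nat := e.1 + e.2.

Lemma wt_additive : additive_weight wt.
Proof. by move=> [a b] [c d]; rewrite /wt addnACA. Qed.

Lemma additive_weight0 c : additive_weight c -> c (0, 0)%N = 0%N.
Proof. by move=> /(_ (0, 0)%N (0, 0)%N)/(congr1 (subn^~ (c (0, 0)%N))); rewrite subnn addnK. Qed.

Section Monomials.
Context (K : fieldType) (G : zmodType) (e1 e2 : G).
Context (basis12 : free_abelian_basis2 e1 e2).
Local Notation L := (free_graded_lie K G).
Local Notation Id := (graded_identities (@ut3_comp K G e1 e2)).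
Local Notation ev := (ev e1 e2).
Local Notation Y := (@vY K G).
Local Notation Z := (vZ K e1).
Local Notation W := (vW K e2).
Local Notation U := (vU K e1 e2).

(** In [cZW] the two exponents of a letter act on separate factors, so words yield all monomials in
    the p_k and q_k; [cZ], [cW] and [cU] see one eigenvalue, hence [wt]. For [cY] the word is
    ignored, as the y's commute modulo the identities. *)
Definition mon (c : cls) (w : word) : L :=
  match c with
  | cY i => Y i
  | cZ i => adw wt 0 w (Z i)
  | cW i => adw wt 0 w (W i)
  | cU i => adw wt 0 w (U i)
  | cZW i j => lie (adw fst 0 w (Z i)) (adw snd 0 w (W j))
  end.

Definition mon_val (v : coords K) (c : cls) (w : word) : UT3 K :=
  match c with
  | cY i => ut3 (pa v i) (pb v i) (pc v i) 0 0 0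
  | cZ i => ut3 0 0 0 (monom wt (eig12 v) w * ps v i) 0 0
  | cW i => ut3 0 0 0 0 (monom wt (eig23 v) w * pt v i) 0
  | cU i => ut3 0 0 0 0 0 (monom wt (eig13 v) w * pr v i)
  | cZW i j => ut3 0 0 0 0 0
      (monom fst (eig12 v) w * ps v i * (monom snd (eig23 v) w * pt v j))
  end.

Lemma ev_Y v i : ev v (Y i) = ut3 (pa v i) (pb v i) (pc v i) 0 0 0.
Proof. by case: (ev_var basis12 v i). Qed.

Lemma ev_adwZ v c w i :
  ev v (adw c 0 w (Z i)) = ut3 0 0 0 (monom c (eig12 v) w * ps v i) 0 0.
Proof.
by have [_ vi _ _] := ev_var basis12 v i; rewrite (ev_adw basis12 _ _ _ vi) !mulr0.
Qed.

Lemma ev_adwW v c w i :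
  ev v (adw c 0 w (W i)) = ut3 0 0 0 0 (monom c (eig23 v) w * pt v i) 0.
Proof.
by have [_ _ vi _] := ev_var basis12 v i; rewrite (ev_adw basis12 _ _ _ vi) !mulr0.
Qed.

Lemma ev_adwU v c w i :
  ev v (adw c 0 w (U i)) = ut3 0 0 0 0 0 (monom c (eig13 v) w * pr v i).
Proof.
by have [_ _ _ vi] := ev_var basis12 v i; rewrite (ev_adw basis12 _ _ _ vi) !mulr0.
Qed.

Lemma ev_mon v c w : ev v (mon c w) = mon_val v c w.
Proof.
case: c => [i|i|i|i|i j] /=; rewrite ?ev_Y ?ev_adwZ ?ev_adwW ?ev_adwU //.
by rewrite ev_lie ev_adwZ ev_adwW ut3_lie; congr ut3; ring.
Qed.

Definition stable (J : set L) : Prop := is_TG_ideal J /\ Id `<=` J.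

Lemma free_comp0 d : free_comp d (0 : L).
Proof. exact: free_comp_0. Qed.

Lemma ev0 (v : coords K) : ev v (0 : L) = 0. Proof. exact: (linear0 (fl_lift _)). Qed.

Lemma evD (v : coords K) (f g : L) : ev v (f + g) = ev v f + ev v g.
Proof. exact: (linearD (fl_lift _)). Qed.

Lemma mon_shift c c' u v : same_kind c c' -> emb pair_le u v ->
  exists (T : {linear L -> L}) (t : word -> word),
    [/\ t u = v, forall w, lt_word w u -> lt_word (t w) v,
        forall J, stable J -> forall x, J x -> J (T x) &
        forall J, stable J -> forall w, size w = size u ->
          J (T (mon c w) - mon c' (t w))].
Proof.
move=> cc' /(emb_shift K)[phi [d [t [tu tlt _ tm]]]].
(* The substitution sends y_i to y_(phi i), all variables of the kind of c' to the one named by c'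
   acted upon by d (for [cZW], each factor takes its own exponents of d), and the other z, w, u to
   0. For [cY] every y_i goes to the target variable. *)
pose y i := if c' is cY i' then Y i' else Y (phi i).
pose z (i : nat) := match c' with
  | cZ i' => adw wt 0 d (Z i') | cZW i' _ => adw fst 0 d (Z i') | _ => 0 end.
pose w (i : nat) := match c' with
  | cW i' => adw wt 0 d (W i') | cZW _ j' => adw snd 0 d (W j') | _ => 0 end.
pose x (i : nat) := if c' is cU i' then adw wt 0 d (U i') else 0.
have Tgr : graded_hom (@free_comp K G) (@free_comp K G) (endo e1 e2 y z w x).
  apply: endo_graded => i; rewrite /y /z /w /x; case: (c') => *;
    by [exact: free_comp_var | exact: free_comp0 | apply: adw_comp; exact: free_comp_var].
exists (endo e1 e2 y z w x), t; split=> // [J [TJ _] f|J [_ IdJ] m mu].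
  exact: (TG_ideal_endo TJ Tgr).
apply/IdJ/(identity_eq basis12) => v'.
pose k i := if c' is cY i' then i' else phi i.
pose s (i : nat) : K := match c' with
  | cZ i' => monom wt (eig12 v') d * ps v' i'
  | cZW i' _ => monom fst (eig12 v') d * ps v' i' | _ => 0 end.
pose r (i : nat) : K := match c' with
  | cW i' => monom wt (eig23 v') d * pt v' i'
  | cZW _ j' => monom snd (eig23 v') d * pt v' j' | _ => 0 end.
pose q (i : nat) : K := if c' is cU i' then monom wt (eig13 v') d * pr v' i' else 0.
rewrite (@ev_endo _ _ _ _ v' (Coords (pa v' \o k) (pb v' \o k) (pc v' \o k) s r q)).
- rewrite !ev_mon; case: (c) cc' => [i|i|i|i|i j]; rewrite /k /s /r /q;
    case: (c') => [i'|i'|i'|i'|i' j'] // _ //=.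
  + by congr ut3; rewrite tm //; [ring|exact: wt_additive].
  + by congr ut3; rewrite tm //; [ring|exact: wt_additive].
  + by congr ut3; rewrite tm //; [ring|exact: wt_additive].
  + congr ut3; rewrite !tm //; ring.
- by move=> i; rewrite /y /k; case: (c') => *; rewrite ev_Y.
- by move=> i; rewrite /z /s; case: (c') => * /=; rewrite ?ev_adwZ ?ev0 ?ut3_0.
- by move=> i; rewrite /w /r; case: (c') => * /=; rewrite ?ev_adwW ?ev0 ?ut3_0.
- by move=> i; rewrite /x /q; case: (c') => * /=; rewrite ?ev_adwU ?ev0 ?ut3_0.
Qed.

Definition mon_sum (l : seq (K * (cls * word))) : L :=
  \sum_(x <- l) x.1 *: mon x.2.1 x.2.2.

Definition spanned : set L := [set f | exists l, Id (f - mon_sum l)].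

Lemma Id_submodule : is_submodule Id.
Proof. by apply: TG_ideal_submodule; exact: graded_identities_TG. Qed.

Lemma spanned_submodule : is_submodule spanned.
Proof.
split=> [|a f g [l lf] [m mg]].
  by exists [::]; rewrite /mon_sum big_nil subrr; exact: (submodule0 Id_submodule).
exists ([seq (a * x.1, x.2) | x <- l] ++ m).
rewrite /mon_sum big_cat big_map /=.
have -> : \sum_(x <- l) (a * x.1) *: mon x.2.1 x.2.2 = a *: mon_sum l.
  by rewrite /mon_sum scaler_sumr; apply: eq_bigr => x _; rewrite scalerA.
rewrite opprD addrACA -scalerBr; exact: (submodule_lin Id_submodule).
Qed.

Lemma spanned_mon c w : spanned (mon c w).
Proof.
exists [:: (1, (c, w))]; rewrite /mon_sum big_seq1 scale1r subrr.
exact: (submodule0 Id_submodule).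
Qed.

Lemma spanned_identity f : Id f -> spanned f.
Proof. by exists [::]; rewrite /mon_sum big_nil subr0. Qed.

Lemma spanned_ev f g : (forall v, ev v f = ev v g) -> spanned g -> spanned f.
Proof.
move=> fg; apply: (submodule_subr spanned_submodule).
exact/spanned_identity/(identity_eq basis12).
Qed.

Lemma monom_mulvar c k e v (P : nat -> K) : additive_weight c ->
  monom c P (word_add (rcons (nseq k (0, 0)%N) e) v) = P k ^+ c e * monom c P v.
Proof.
move=> cD; by rewrite (monom_add _ _ _ cD) monom_var //; exact: additive_weight0.
Qed.

Lemma monom_map c (h : nat * nat -> nat * nat) (P : nat -> K) (w : word) :
  monom c P (map h w) = monom (c \o h) P w.
Proof. by elim: w P => //= e w IH P; rewrite IH. Qed.

Lemma monom0 c (P : nat -> K) (w : word) : c =1 (fun=> 0%N) -> monom c P w = 1.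
Proof. by move=> c0; elim: w P => //= e w IH P; rewrite c0 mul1r IH. Qed.

Lemma assignment_cases k d :
  let A v := assignment e1 e2 v (k, d) in
  (forall v : coords K, A v = ut3 (pa v k) (pb v k) (pc v k) 0 0 0) \/
  (forall v : coords K, A v = ut3 0 0 0 (ps v k) 0 0) \/
  (forall v : coords K, A v = ut3 0 0 0 0 (pt v k) 0) \/
  (forall v : coords K, A v = ut3 0 0 0 0 0 (pr v k)) \/
  (forall v : coords K, A v = 0).
Proof.
rewrite /assignment /on_support /=.
by case: (d == 0); case: (d == e1); case: (d == e2); case: (d == e1 + e2); tauto.
Qed.

Lemma spanned_lie_mon x c w : spanned (lie (fl_var K x : L) (mon c w)).
Proof.
case: x => k d.
have ev_lhs v : ev v (lie (fl_var K (k, d) : L) (mon c w)) =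
    lie (assignment e1 e2 v (k, d)) (mon_val v c w).
  by rewrite ev_lie ev_mon /ev fl_lift_var.
(* Multiplication of the monomial of u by the letter e at place k. *)
pose lm k e u := word_add (rcons (nseq k (0, 0)%N) e) u.
have zero : (forall v, lie (assignment e1 e2 v (k, d)) (mon_val v c w) = 0) ->
    spanned (lie (fl_var K (k, d) : L) (mon c w)).
  move=> v0; apply: (@spanned_ev _ 0); last exact: (submodule0 spanned_submodule).
  by move=> v; rewrite ev_lhs v0 ev0.
have one a c' w' : (forall v, lie (assignment e1 e2 v (k, d)) (mon_val v c w) =
      a *: mon_val v c' w') -> spanned (lie (fl_var K (k, d) : L) (mon c w)).
  move=> v1; apply: (@spanned_ev _ (a *: mon c' w')).
    by move=> v; rewrite ev_lhs v1 linearZ /= ev_mon.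
  exact/(submoduleZ spanned_submodule)/spanned_mon.
have lm_wt u v P : monom wt P (lm u (1, 0)%N v) = P u * monom wt P v :> K.
  by rewrite monom_mulvar ?expr1 //; exact: wt_additive.
have [AE|[AE|[AE|[AE|AE]]]] := assignment_cases k d.
- case: c ev_lhs zero one => [i|i|i|i|i j] ev_lhs zero one.
  + by apply: zero => v; rewrite AE ut3_lie; apply: ut3_eq0; ring.
  + apply: (one 1 (cZ i) (lm k (1, 0)%N w)) => v; rewrite AE /=.
    rewrite scale1r ut3_lie lm_wt; congr ut3; rewrite /eig12; ring.
  + apply: (one 1 (cW i) (lm k (1, 0)%N w)) => v; rewrite AE /=.
    rewrite scale1r ut3_lie lm_wt; congr ut3; rewrite /eig23; ring.
  + apply: (one 1 (cU i) (lm k (1, 0)%N w)) => v; rewrite AE /=.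
    rewrite scale1r ut3_lie lm_wt; congr ut3; rewrite /eig13; ring.
  (* The eigenvalue on e13 is p_k + q_k, whence one word for each summand. *)
  apply: (@spanned_ev _ (mon (cZW i j) (lm k (1, 0)%N w) +
                        mon (cZW i j) (lm k (0, 1)%N w))); last first.
    by apply: (submoduleD spanned_submodule); exact: spanned_mon.
  move=> v; rewrite ev_lhs AE evD !ev_mon /= -[X in X + _]scale1r ut3_lin ut3_lie.
  rewrite !monom_mulvar //= ?expr1 ?expr0 ?mul1r.
  by congr ut3; rewrite /eig12 /eig23; ring.
- case: c ev_lhs zero one => [i|i|i|i|i j] ev_lhs zero one;
    try by apply: zero => v; rewrite AE ut3_lie; apply: ut3_eq0; ring.
  + apply: (one (-1) (cZ k) (lm i (1, 0)%N [::])) => v; rewrite AE /=.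
    rewrite ut3Z ut3_lie lm_wt /=; congr ut3; rewrite /eig12; ring.
  (* The word acted on the w-variable alone, so all its exponents become exponents of the q's. *)
  + apply: (one 1 (cZW k i) (map (fun e => (0, wt e)%N) w)) => v; rewrite AE /=.
    rewrite scale1r ut3_lie !monom_map (@monom0 _ (eig12 v)) //.
    have -> : monom (snd \o (fun e => (0, wt e)%N)) (eig23 v) w = monom wt (eig23 v) w.
      exact: eq_monom.
    by congr ut3; ring.
- case: c ev_lhs zero one => [i|i|i|i|i j] ev_lhs zero one;
    try by apply: zero => v; rewrite AE ut3_lie; apply: ut3_eq0; ring.
  + apply: (one (-1) (cW k) (lm i (1, 0)%N [::])) => v; rewrite AE /=.
    rewrite ut3Z ut3_lie lm_wt /=; congr ut3; rewrite /eig23; ring.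
  + apply: (one (-1) (cZW i k) (map (fun e => (wt e, 0)%N) w)) => v; rewrite AE /=.
    rewrite ut3Z ut3_lie !monom_map (@monom0 _ (eig23 v)) //.
    have -> : monom (fst \o (fun e => (wt e, 0)%N)) (eig12 v) w = monom wt (eig12 v) w.
      exact: eq_monom.
    by congr ut3; ring.
- case: c ev_lhs zero one => [i|i|i|i|i j] ev_lhs zero one;
    try by apply: zero => v; rewrite AE ut3_lie; apply: ut3_eq0; ring.
  apply: (one (-1) (cU k) (lm i (1, 0)%N [::])) => v; rewrite AE /=.
  by rewrite ut3Z ut3_lie lm_wt /=; congr ut3; rewrite /eig13; ring.
- by apply: zero => v; rewrite AE; exact: lie0l.
Qed.

Lemma spanned_var x : spanned (fl_var K x).
Proof.
case: x => k d.
have [->|d0] := eqVneq d 0; first exact: (spanned_mon (cY k) [::]).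
have [->|d1] := eqVneq d e1; first exact: (spanned_mon (cZ k) [::]).
have [->|d2] := eqVneq d e2; first exact: (spanned_mon (cW k) [::]).
have [->|d3] := eqVneq d (e1 + e2); first exact: (spanned_mon (cU k) [::]).
apply/spanned_identity/(identityP basis12) => v; rewrite /ev fl_lift_var.
rewrite /assignment /on_support /=.
by rewrite (negPf d0) (negPf d1) (negPf d2) (negPf d3).
Qed.

Lemma spanned_all f : spanned f.
Proof.
apply: (fl_generate spanned_submodule spanned_var) => x g [l lg].
have IdTG := graded_identities_TG (@ut3_comp K G e1 e2).
have gl : Id (lie (fl_var K x : L) g - lie (fl_var K x : L) (mon_sum l)).
  rewrite -scaleN1r -lieZr -lieDr scaleN1r; exact: (TG_ideal_lie IdTG).
apply: (submodule_subr spanned_submodule (spanned_identity gl)).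
rewrite /mon_sum; elim: l {lg gl} => [|y l IH].
  by rewrite big_nil lie0r; exact: (submodule0 spanned_submodule).
rewrite big_cons lieDr lieZr; apply: (submodule_lin spanned_submodule) => //.
exact: spanned_lie_mon.
Qed.

(** * Projections onto the classes by substituting zeros *)

Definition mask (al : nat -> bool) (a : nat -> K) (i : nat) : K :=
  if al i then a i else 0.

Definition kill (al be ga de : nat -> bool) : L -> L :=
  endo e1 e2 (fun i => if al i then Y i else 0) (fun i => if be i then Z i else 0)
    (fun i => if ga i then W i else 0) (fun i => if de i then U i else 0).

Lemma kill_stable J al be ga de f : stable J -> J f -> J (kill al be ga de f).
Proof.
move=> [TJ _]; apply: (TG_ideal_endo TJ); apply: endo_graded => i;
  by case: ifP => _; [exact: free_comp_var|exact: free_comp0].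
Qed.

Lemma ev_kill v al be ga de f : ev v (kill al be ga de f) =
  ev (Coords (mask al (pa v)) (mask al (pb v)) (mask al (pc v))
    (mask be (ps v)) (mask ga (pt v)) (mask de (pr v))) f.
Proof.
apply: ev_endo => i; have [vy vz vw vu] := ev_var basis12 v i;
  by rewrite /mask /=; case: ifP => _; rewrite ?ev0 ?ut3_0.
Qed.

(** Inclusion-exclusion: keep the z, w, u named by c, then subtract what survives with fewer of
    them. Monomials are products of at most one variable of each kind acted upon by y's, so only
    those of class c remain. All y's are kept, except for [cY]. *)
Definition proj (c : cls) (f : L) : L :=
  match c with
  | cY i => kill (pred1 i) pred0 pred0 pred0 f
  | cZ i => kill predT (pred1 i) pred0 pred0 f - kill predT pred0 pred0 pred0 f
  | cW i => kill predT pred0 (pred1 i) pred0 f - kill predT pred0 pred0 pred0 f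
  | cU i => kill predT pred0 pred0 (pred1 i) f - kill predT pred0 pred0 pred0 f
  | cZW i j =>
      (kill predT (pred1 i) (pred1 j) pred0 f - kill predT (pred1 i) pred0 pred0 f)
      - (kill predT pred0 (pred1 j) pred0 f - kill predT pred0 pred0 pred0 f)
  end.

Lemma proj_stable J c f : stable J -> J f -> J (proj c f).
Proof.
move=> Jst Jf; have kJ al be ga de := kill_stable al be ga de Jst Jf.
have subJ := TG_ideal_submodule Jst.1.
by case: c => *; rewrite /proj //; do 2?apply: (submoduleB subJ).
Qed.

Lemma evB (v : coords K) (f g : L) : ev v (f - g) = ev v f - ev v g.
Proof. exact: (linearB (fl_lift _)). Qed.

Lemma evZ (v : coords K) a (f : L) : ev v (a *: f) = a *: ev v f.
Proof. exact: (linearZZ (fl_lift _)). Qed.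

Lemma ev_proj_mon v c c' w :
  ev v (proj c (mon c' w)) = if c' == c then ev v (mon c' w) else 0.
Proof.
have [<-|cc] := eqVneq c' c.
  case: c' => [i|i|i|i|i j]; rewrite /proj ?evB !ev_kill !ev_mon /= ?ut3B /mask /= ?eqxx;
    by congr ut3; ring.
case: c c' cc => [i|i|i|i|i j] [i'|i'|i'|i'|i' j'] cc;
  rewrite /proj ?evB !ev_kill !ev_mon /= ?ut3B /mask /=; apply: ut3_eq0;
  first [ring | rewrite (_ : (i' == i) = false);
                [by ring | by apply: contraNF cc => /eqP-> ] | idtac].
have [ii|_] := eqVneq i' i; have [jj|_] := eqVneq j' j; try ring.
by rewrite ii jj eqxx in cc.
Qed.

Lemma proj_lin c a f g : proj c (a *: f + g) = a *: proj c f + proj c g.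
Proof.
have kP al be ga de : kill al be ga de (a *: f + g) =
    a *: kill al be ga de f + kill al be ga de g by exact: linearP.
have subP (x y x' y' : L) :
    (a *: x + y) - (a *: x' + y') = a *: (x - x') + (y - y').
  by rewrite opprD addrACA scalerBr.
by case: c => *; rewrite /proj !kP ?subP.
Qed.

Lemma proj_mon_sum c l :
  Id (proj c (mon_sum l) - mon_sum [seq x <- l | x.2.1 == c]).
Proof.
apply: (identity_eq basis12) => v; elim: l => [|x l IH].
  rewrite /mon_sum !big_nil; have := proj_lin c (-1) 0 0.
  by rewrite !scaleN1r !addNr => ->.
rewrite /mon_sum big_cons proj_lin evD evZ ev_proj_mon IH /=; case: ifP => _.
  by rewrite big_cons evD evZ.
by rewrite scaler0 add0r.
Qed.

(** * Finite generation *)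

(** Brings words to a common length, as [lt_word] requires; the letter (0, 0) acts trivially. *)
Definition pad n (w : word) : word := w ++ nseq (n - size w) (0, 0)%N.

Lemma mon_pad n c w : Id (mon c w - mon c (pad n w)).
Proof.
apply: (identity_eq basis12) => v; rewrite !ev_mon.
by case: c => *; rewrite /= /pad ?monom_pad.
Qed.

(** Shifts link classes of one kind, so each kind is treated apart. Pairs of indices accommodate
    [cZW]; the other kinds will use the first component. *)
Lemma kind_finite_basis J (k : nat * nat -> cls) :
  (forall x y, same_kind (k x) (k y)) -> stable J ->
  exists S : seq L, (forall x, x \in S -> J x) /\
    forall J', stable J' -> (forall x, x \in S -> J' x) ->
      forall n x l, (forall y, y \in l -> size y.2 = n) ->
        J (comb mon (k x) l) -> J' (comb mon (k x) l).
Proof.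
move=> kk Jst.
apply: (@stable_finite_basis _ _ _ (fun x => mon (k x)) stable _ _ J Jst).
  by move=> J' [TJ' _]; exact: TG_ideal_submodule.
move=> x y u v; exact: mon_shift.
Qed.

Lemma class_finite_basis J : stable J ->
  exists S : seq L, (forall x, x \in S -> J x) /\
    forall J', stable J' -> (forall x, x \in S -> J' x) ->
      forall n c l, (forall y, y \in l -> size y.2 = n) ->
        J (comb mon c l) -> J' (comb mon c l).
Proof.
move=> Jst.
have [SY [JY bY]] := @kind_finite_basis J (fun x => cY x.1) (fun _ _ => isT) Jst.
have [SZ [JZ bZ]] := @kind_finite_basis J (fun x => cZ x.1) (fun _ _ => isT) Jst.
have [SW [JW bW]] := @kind_finite_basis J (fun x => cW x.1) (fun _ _ => isT) Jst.
have [SU [JU bU]] := @kind_finite_basis J (fun x => cU x.1) (fun _ _ => isT) Jst.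
have [SV [JV bV]] := @kind_finite_basis J (fun x => cZW x.1 x.2) (fun _ _ => isT) Jst.
exists (SY ++ SZ ++ SW ++ SU ++ SV); split=> [x|J' J'st SJ' n c l ln].
  by rewrite !mem_cat => /or4P[/JY|/JZ|/JW|/orP[/JU|/JV]].
have sub x : [|| x \in SY, x \in SZ, x \in SW, x \in SU | x \in SV] -> J' x.
  by move=> xS; apply: SJ'; rewrite !mem_cat.
case: c => [i|i|i|i|i j].
- by apply: (bY J' J'st _ n (i, 0%N) l ln) => x xS; apply: sub; rewrite xS.
- by apply: (bZ J' J'st _ n (i, 0%N) l ln) => x xS; apply: sub; rewrite xS orbT.
- by apply: (bW J' J'st _ n (i, 0%N) l ln) => x xS; apply: sub; rewrite xS !orbT.
- by apply: (bU J' J'st _ n (i, 0%N) l ln) => x xS; apply: sub; rewrite xS !orbT.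
- by apply: (bV J' J'st _ n (i, j) l ln) => x xS; apply: sub; rewrite xS !orbT.
Qed.

(** Modulo the identities an element of J is a sum of monomials; its projections put each class part
    in J, the finite bases carry the parts to J', and the element is congruent to their sum. *)
Lemma stable_finitely_generated J : stable J ->
  exists S : seq L, (forall x, x \in S -> J x) /\
    forall J', stable J' -> (forall x, x \in S -> J' x) -> J `<=` J'.
Proof.
move=> Jst; have [S [SJ bS]] := class_finite_basis Jst.
exists S; split=> // J' J'st SJ' f Jf.
have subJ := TG_ideal_submodule Jst.1; have subJ' := TG_ideal_submodule J'st.1.
have [l0 fl0] := spanned_all f.
pose n := (\max_(x <- l0) size x.2.2)%N.
pose l := [seq (x.1, (x.2.1, pad n x.2.2)) | x <- l0].
have fl : Id (f - mon_sum l).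
  rewrite -(subrKA (mon_sum l0)); apply: (submoduleD Id_submodule fl0).
  rewrite /mon_sum big_map -sumrB; apply: (submodule_sum Id_submodule) => x _.
  by rewrite -scalerBr; apply: (submoduleZ Id_submodule); exact: mon_pad.
have ln x : x \in l -> size x.2.2 = n.
  case/mapP=> y yl0 -> /=; rewrite size_cat size_nseq subnKC //.
  by rewrite /n (big_rem y yl0) leq_maxl.
have Jl : J (mon_sum l) by apply: (submodule_subl subJ) Jf; exact: Jst.2.
apply: (submodule_subr subJ' (J'st.2 _ fl)).
pose part c := comb mon c [seq (x.1, x.2.2) | x <- [seq x <- l | x.2.1 == c]].
have partE c : part c = mon_sum [seq x <- l | x.2.1 == c].
  rewrite /part /comb /mon_sum big_map !big_filter.
  by apply: eq_bigr => x /eqP->.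
have J'part c : J' (part c).
  apply: (bS J' J'st SJ' n).
    by move=> y /mapP[x]; rewrite mem_filter => /andP[_ /ln xn] ->.
  rewrite -/(part c) partE.
  by apply: (submodule_subl subJ (Jst.2 _ (proj_mon_sum c l))); exact: proj_stable.
(* Regrouping by class, with [undup] so that each class is counted once. *)
have -> : mon_sum l = \sum_(c <- undup [seq x.2.1 | x <- l]) part c.
  under eq_bigr => c _ do rewrite partE /mon_sum big_filter.
  rewrite (exchange_big_dep xpredT) //=; apply: eq_big_seq => x xl.
  rewrite (eq_bigl (pred1 x.2.1)) => [|c]; last by rewrite /= eq_sym.
  rewrite -big_filter filter_pred1_uniq; [|exact: undup_uniq|].
    by rewrite big_seq1.
  by rewrite mem_undup; apply/mapP; exists x.
by apply: (submodule_sum subJ').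
Qed.

End Monomials.

Unset Implicit Arguments.

Theorem theorem3p11 (K : fieldType) (G : zmodType) (e1 e2 : G)
    (J : set (free_graded_lie K G)) :
  infinite_set [set: K] ->
  free_abelian_basis2 e1 e2 ->
  is_TG_ideal J ->
  graded_identities (@ut3_comp K G e1 e2) `<=` J ->
  exists S : set (free_graded_lie K G),
    finite_set S /\
    J = [set u + v | u in TG_ideal_gen S
                   & v in graded_identities (@ut3_comp K G e1 e2)].
Proof.
move=> _ basis12 TJ IdJ.
have [S [SJ genS]] := stable_finitely_generated basis12 (conj TJ IdJ).
have TId := graded_identities_TG (@ut3_comp K G e1 e2).
have Tgen := TG_ideal_gen_TG [set` S].
exists [set` S]; split; first exact: finite_seq.
apply/seteqP; split=> [|_ [u Su [v Iv <-]]].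
  (* Here J' is the sum of the two ideals, a T_G-ideal containing both S and the identities. *)
  apply: genS => [|x xS]; first split; first exact: TG_ideal_sum.
    by move=> v Iv; exists 0; [exact: TG_ideal0|exists v; rewrite ?add0r].
  by exists x; [exact: sub_gen_smallest|exists 0; [exact: TG_ideal0|rewrite addr0]].
apply: (submoduleD (TG_ideal_submodule TJ)); last exact: IdJ.
by apply: Su; split=> // x; exact: SJ.
Qed.
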